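(* Let $k\ge 1$ be an integer and $0<a<b<\infty$. Then $Z_k:=Z_k([-b,-a],[a,b])$ satisfies \[ Z_k=4\rho^{-2k}\prod_{\tau=1}^{\infty}\frac{(1+\rho^{-8\tau k})^4}{(1+\rho^{4k}\rho^{-8\tau k})^4},\qquad \rho=\exp\left(\frac{\pi^2}{2\mu(a/b)}\right), \] where $\mu$ is the Gr\''otzsch ring function.
   Context: For an integer $k\ge 0$, $\mathcal{R}_{k,k}$ is the set of irreducible rational functions $p(x)/q(x)$ with $p,q$ complex polynomials of degree at most $k$. For closed disjoint sets $E,F\subset\mathbb{C}$ the Zolotarev number is \[ Z_k(E,F):=\inf_{r\in\mathcal{R}_{k,k}}\frac{\sup_{z\in E}|r(z)|}{\inf_{z\in F}|r(z)|}, \] where $|r(z)|=\infty$ at poles of $r$, and only $r$ with $\sup_{z\in E}|r(z)|<\infty$ and $\inf_{z\in F}|r(z)|>0$ need be considered. The Gr\''otzsch ring function is $\mu(\lambda)=\frac{\pi}{2}\,K(\sqrt{1-\lambda^2})/K(\lambda)$ for $0<\lambda<1$, where $K(\lambda)=\int_0^1 \frac{dt}{\sqrt{(1-t^2)(1-\lambda^2t^2)}}$ is the complete elliptic integral of the first kind. *)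

(* Defs.v *)
From mathcomp Require Import all_boot all_order all_algebra.
From mathcomp Require Import complex.
From mathcomp Require Import all_classical all_reals all_analysis.

Set Implicit Arguments.
Unset Strict Implicit.
Unset Printing Implicit Defensive.

Import Order.TTheory GRing.Theory Num.Theory.
Import numFieldNormedType.Exports.

Local Open Scope classical_set_scope.
Local Open Scope ring_scope.
Local Open Scope complex_scope.

(* The pair (p, q) represents the rational function p / q; [size] is the
   degree plus one. *)
Definition ratfun {R : realType} (k : nat) : set ({poly R[i]} * {poly R[i]}) :=
  [set r | [/\ r.2 != 0, coprimep r.1 r.2,
               (size r.1 <= k.+1)%N & (size r.2 <= k.+1)%N]].

(* |r(z)|.  For coprime p and q the poles of p / q are the roots of q. *)
Definition ratfun_abs {R : realType} (r : {poly R[i]} * {poly R[i]})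
    (z : R[i]) : \bar R :=
  if root r.2 z then +oo%E
  else (ComplexField.Normc.normc (r.1.[z] / r.2.[z]))%:E.

Definition zolo_sup {R : realType} (E : set R[i])
    (r : {poly R[i]} * {poly R[i]}) : \bar R :=
  ereal_sup (ratfun_abs r @` E).

Definition zolo_inf {R : realType} (F : set R[i])
    (r : {poly R[i]} * {poly R[i]}) : \bar R :=
  ereal_inf (ratfun_abs r @` F).

(* The restriction on r excludes the indeterminate quotients oo/oo and 0/0. *)
Definition zolotarev {R : realType} (k : nat) (E F : set R[i]) : \bar R :=
  ereal_inf [set (zolo_sup E r / zolo_inf F r)%E | r in
    [set r | [/\ ratfun k r, (zolo_sup E r < +oo)%E & (0 < zolo_inf F r)%E]]].

Definition real_segment {R : realType} (a b : R) : set R[i] :=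
  (fun x : R => x%:C) @` `[a, b].

(* The integrand is nonnegative, so the Lebesgue integral coincides with the
   improper Riemann integral; the interval is open because 0^-1 = 0. *)
Definition ellipticK {R : realType} (l : R) : R :=
  \int[lebesgue_measure]_(t in `]0, 1[)
    (Num.sqrt ((1 - t ^+ 2) * (1 - l ^+ 2 * t ^+ 2)))^-1.

Definition grotzsch {R : realType} (l : R) : R :=
  pi / 2 * (ellipticK (Num.sqrt (1 - l ^+ 2)) / ellipticK l).

(* Main.v *)
Require Import Defs.
From HB Require Import structures.
From mathcomp Require Import all_boot all_order all_algebra.
From mathcomp Require Import finmap complex.
From mathcomp Require Import all_classical all_reals all_analysis measurable_realfun.
From mathcomp Require Import ring lra zify.

Set Implicit Arguments.
Unset Strict Implicit.
Unset Printing Implicit Defensive.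

Import Order.TTheory GRing.Theory Num.Theory.
Import numFieldNormedType.Exports.

Local Open Scope classical_set_scope.
Local Open Scope ring_scope.

(** Fix a nome 0 < s < 1. For z > 0 let E and O be the sums of s^(n^2) z^n over
    the even and over the odd integers n, and put X_s = O / E
    ([theta_ratio]) and H_s = (1 - X_s) / (1 + X_s) ([theta_quot]). Two
    descriptions of H_s play against each other.

    As an infinite product (Jacobi's triple product, [theta_quot_cvg]) H_s is
    the product over b = s, s^3, s^5, ... of
    (1 - b z)(1 - b / z) / ((1 + b z)(1 + b / z)). Hence |H_s| is largest at
    z = 1, H_s(s^2 z) = - H_s(z), the zeros are the odd powers of s, and H_r is
    a product of shifted copies of H_Q when Q is a power of r
    ([theta_quot_mult]). As a quotient of series it has an addition theorem
    ([theta_quot_add]): multiplying two series and changing variables in the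
    double sum expresses H_{s^2}(z w) H_{s^2}(z / w) through X_s(z) X_s(w).
    Taking Q = r^(2k) and pairing the factors, H_r(z)^2 becomes the square of a
    rational function of degree k evaluated at X_{r^k}(z)
    ([theta_quot_rational]).

    Let a / b = X_{r^k}(1)^2. While z increases from 1 to r^(-2k), the point
    x = - sqrt(a b) X_{r^k}(z) runs through [-b, -a] and the rational function
    R(x) just found oscillates between the values +- H_r(1), reached at the
    even powers of r, with its zeros at the odd powers. Moreover R(- x) is
    +- 1 / R(x), so that |R| is at least 1 / H_r(1) on [a, b]: R has ratio
    H_r(1)^2. No complex competitor p / q does better ([zolotarev_ge]). On the
    real line |p|^2 and |q|^2 are real polynomials of degree at most 2k, so
    that one compares |p / q|^2 with R^2: clearing denominators gives a real
    polynomial of degree at most 4k whose values at the 4k + 2 extremal points,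
    zeros and poles of R weakly alternate in sign, and such a polynomial
    vanishes at these points ([alternating_poly_eq0]); but a better competitor
    makes its value at - b positive. Thus Z_k = H_r(1)^2 ([zolotarev_theta]).

    It remains to find r from a / b. Write N(l) = pi K(l') / K(l), where
    l' = sqrt(1 - l^2) ([period_ratio], which is twice the Groetzsch function).
    By Landen's transformation N(x) = 2 N(l) when l = 2 sqrt(x) / (1 + x), and
    the addition theorem shows that l = X_s(1)^2 and x = X_{s^2}(1)^2 are
    related in this way. Iterating from l to x leads to small moduli, where
    N(l) = - 2 ln l + O(1), and to small nomes, where X_s(1) is comparable to s;
    the errors are divided by 2^n on the way back, so that
    N(X_s(1)^2) = - 4 ln s exactly ([period_ratio_theta]), and for a similar
    reason N is injective ([period_ratio_inj]). Therefore
    X_{r^k}(1)^2 = a / b for r^k = exp(- N(a / b) / 4). Exchanging a modulus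
    with its complement inverts N up to the factor pi^2, which turns H_r(1)^2
    into X_s(1)^2 with ln r ln s = pi^2 / 4
    ([theta_imaginary_transformation]); for this r the nome s^4 is rho^(-4k),
    and the product for X_s(1) ([theta_ratio1_prod]) is the one of the
    theorem. *)

(** * Sums over the integers and over the lattice of pairs of integers *)

Lemma esumZl (R : realType) (T : choiceType) (S : set T) (c : R)
    (a : T -> \bar R) : 0 < c -> (forall i, S i -> 0 <= a i)%E ->
  (\esum_(i in S) (c%:E * a i) = c%:E * \esum_(i in S) a i)%E.
Proof.
move=> c0 a0; rewrite /esum -ereal_sup_pZl//; congr ereal_sup.
have key X : finite_set X -> X `<=` S ->
    (\sum_(i \in X) (c%:E * a i) = c%:E * \sum_(i \in X) a i)%E.
  move=> fX XS; rewrite !fsbig_finite//= big_seq [in RHS]big_seq.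
  rewrite ge0_sume_distrr// => i.
  by rewrite in_fset_set// inE => /XS /a0.
apply/seteqP; split=> x /=.
  move=> [X [fX XS] <-]; exists (\sum_(i \in X) a i)%E; first by exists X.
  by rewrite key.
by move=> [y [X [fX XS] <-] <-]; exists X => //; rewrite key.
Qed.

(** The sum over pairs is taken over one index first; G = 0 is set apart because
    only positive constants are pulled out of a sum. *)
Lemma esum_mul (R : realType) (T U : choiceType)
    (f : T -> R) (g : U -> R) (F G : R) :
  (forall i, 0 < f i) -> (forall j, 0 < g j) ->
  \esum_(i in [set: T]) (f i)%:E = F%:E ->
  \esum_(j in [set: U]) (g j)%:E = G%:E ->
  \esum_(p in [set: T * U]) (f p.1 * g p.2)%:E = (F * G)%:E.
Proof.
move=> f0 g0 hF hG.
have G0 : 0 <= G.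
  by rewrite -lee_fin -hG; apply: esum_ge0 => j _; rewrite lee_fin ltW.
have -> : [set: T * U] = [set: T] `*`` (fun=> [set: U]).
  by apply/seteqP; split=> -[].
rewrite -(@esum_esum _ _ _ _ _ (fun i j => (f i * g j)%:E)); last first.
  by move=> i j _ _; rewrite lee_fin mulr_ge0 ?ltW.
transitivity (\esum_(i in [set: T]) ((f i * G)%:E)).
  apply: eq_esum => i _; under eq_esum do rewrite EFinM.
  rewrite esumZl ?hG ?EFinM// => j _; rewrite lee_fin ltW//.
have [G00|G00] := eqVneq G 0.
  by rewrite G00 mulr0 esum1// => i _; rewrite mulr0.
have Gp : 0 < G by rewrite lt_neqAle eq_sym G00.
under eq_esum do rewrite mulrC EFinM.
rewrite esumZl ?hF 1?mulrC ?EFinM// => j _; rewrite lee_fin ltW//.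
Qed.

(** This is the change of variables x = a + c, y = a - c on pairs of integers:
    its image is the sublattice where x + y is even, and the other coset is the
    translate of the image by (1, 0). *)
Lemma esum_int2_parity (R : realType) (F : int * int -> \bar R) :
  (forall p, 0 <= F p)%E ->
  (\esum_(p in [set: int * int]) F p =
   \esum_(p in [set: int * int]) F (p.1 + p.2, p.1 - p.2)%R +
   \esum_(p in [set: int * int]) F (p.1 + p.2 + 1, p.1 - p.2)%R)%E.
Proof.
move=> F0.
pose B := [set p : int * int | exists a : int, p.1 + p.2 = a + a].
rewrite (esumID B); last by move=> p _; exact: F0.
congr (_ + _)%E.
  apply: (reindex_esum _ _ (fun p : int * int => (p.1 + p.2, p.1 - p.2))).
  split.
  - by move=> [a c] _; split=> //=; exists a => /=; lia.
  - move=> [a c] [a' c'] _ _ /= [h1 h2]; congr (_, _); lia.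
  - move=> [x y] [_ [a /= h]]; exists (a, a - y) => //=.
    by congr (_, _); lia.
apply: (reindex_esum _ _ (fun p : int * int => (p.1 + p.2 + 1, p.1 - p.2))).
split.
- move=> [a c] _; split=> //= -[a' /=]; lia.
- move=> [a c] [a' c'] _ _ /= [h1 h2]; congr (_, _); lia.
- move=> [x y] [_ /= h].
  have [a ha] : exists a : int, x + y = a + a + 1.
    exists (((x + y) %/ 2)%Z).
    have {}h : x + y <> ((x + y) %/ 2)%Z + ((x + y) %/ 2)%Z.
      by move=> h'; apply: h; exists (((x + y) %/ 2)%Z).
    by lia.
  exists (a, a - y) => //=.
  by congr (_, _); lia.
Qed.

(** Monotone convergence: a finite partial sum of the limit is the limit of
    finite partial sums, each below the full sum. *)
Lemma esum_monotone_cvg (R : realType) (T : choiceType)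
    (f : nat -> T -> R) (g : T -> R) :
  (forall n t, 0 <= f n t) ->
  (forall t, nondecreasing_seq (f ^~ t)) ->
  (forall t, f n t @[n --> \oo] --> g t) ->
  \esum_(t in [set: T]) (f n t)%:E @[n --> \oo] -->
  \esum_(t in [set: T]) (g t)%:E.
Proof.
move=> f0 fnd fg.
have fleg n t : f n t <= g t.
  rewrite -(cvg_lim _ (fg t))//; apply: nondecreasing_cvgn_le => //.
  by apply/cvg_ex; exists (g t).
have nd : nondecreasing_seq (fun n => \esum_(t in [set: T]) (f n t)%:E).
  by move=> m n mn; apply: le_esum => t _; rewrite lee_fin fnd.
suff -> : \esum_(t in [set: T]) (g t)%:E =
    ereal_sup (range (fun n => \esum_(t in [set: T]) (f n t)%:E)).
  exact: ereal_nondecreasing_cvgn.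
apply/eqP; rewrite eq_le; apply/andP; split; last first.
  apply: ge_ereal_sup => _ [n _ <-]; apply: le_esum => t _.
  by rewrite lee_fin.
apply: ge_ereal_sup => _ [X [fX _] <-].
rewrite fsbig_finite//= sumEFin.
have h : (\sum_(i <- fset_set X) f n i)%:E @[n --> \oo] -->
         (\sum_(i <- fset_set X) g i)%:E.
  apply: cvg_EFin; first by near=> n.
  by apply: cvg_big => [|i _]; [exact: add_continuous|exact: fg].
rewrite -(cvg_lim _ h)//; apply: lime_le; first by apply/cvg_ex; eexists; exact: h.
apply: nearW => n; apply: le_trans; last first.
  by apply: ereal_sup_ubound; exists n.
rewrite -sumEFin -fsbig_finite//.
by apply: ereal_sup_ubound; exists X.
Unshelve. all: by end_near. Qed.

(** * Quotients of Gaussian binomial coefficients *)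

Section JacobiCoefficients.
Variables (R : realType) (q : R).
Hypotheses (q0 : 0 < q) (q1 : q < 1).

(** The Gaussian binomial coefficient [2N, N + n] divided by the central one
    [2N, N]. For n > N the truncated difference N - j reaches 0, so that the
    product vanishes as the coefficient does. *)
Definition gauss (N n : nat) : R :=
  \prod_(j < n) ((1 - q ^+ (N - j)) / (1 - q ^+ (N + j).+1)).

Let qX n : q ^+ n.+1 < 1. Proof. by rewrite exprn_ilt1 // ltW. Qed.
Let qXle n : q ^+ n <= 1. Proof. by rewrite exprn_ile1 // ltW. Qed.
Let qXn n : 1 - q ^+ n.+1 != 0.
Proof. by rewrite subr_eq0 eq_sym lt_eqF. Qed.

Lemma gauss0 N : gauss N 0 = 1. Proof. by rewrite /gauss big_ord0. Qed.

Lemma gaussS N n :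
  gauss N n.+1 = gauss N n * ((1 - q ^+ (N - n)) / (1 - q ^+ (N + n).+1)).
Proof. by rewrite /gauss big_ord_recr. Qed.

Lemma gauss_ge0 N n : 0 <= gauss N n.
Proof.
by apply: prodr_ge0 => j _; rewrite divr_ge0 ?subr_ge0 ?qXle.
Qed.

Lemma gauss_eq0 N n : (N < n)%N -> gauss N n = 0.
Proof.
elim: n => // n IH; rewrite ltnS leq_eqVlt gaussS => /orP[/eqP <-|/IH ->].
  by rewrite subnn expr0 subrr mul0r mulr0.
by rewrite mul0r.
Qed.

Lemma gaussSS N n :
  gauss N.+1 n.+1 = gauss N n * ((1 - q ^+ N.+1) ^+ 2 /
    ((1 - q ^+ (N + n).+1) * (1 - q ^+ (N + n).+2))).
Proof.
elim: n => [|n IH].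
  rewrite gaussS !gauss0 subn0 !addn0 !mul1r expr2.
  by field; rewrite !qXn.
rewrite gaussS IH (gaussS N n) subSS addSn !addnS.
by field; rewrite !qXn.
Qed.

(** The quotient of consecutive central coefficients, [2N + 2, N + 1] by
    [2N, N]; it normalizes the recurrence in N. *)
Definition jac_ratio N : R :=
  (1 - q ^+ (2 * N).+1) * (1 - q ^+ (2 * N).+2) / (1 - q ^+ N.+1) ^+ 2.

(** This recurrence and the next one are what multiplication of a Laurent
    polynomial by (1 + q^(N + 1/2) z)(1 + q^(N + 1/2) / z) does to the normalized
    coefficients of z^0 and of z^(n + 1). *)
Lemma gauss_rec0 N : jac_ratio N * gauss N.+1 0 =
  (1 + q ^+ (2 * N).+1) * gauss N 0 + 2 * q ^+ N.+1 * gauss N 1.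
Proof.
rewrite gaussS !gauss0 subn0 addn0 /jac_ratio mul1r.
have -> : q ^+ (2 * N).+1 = q * q ^+ N * q ^+ N by rewrite mul2n -addnn exprS exprD mulrA.
have -> : q ^+ (2 * N).+2 = q * q * q ^+ N * q ^+ N.
  by rewrite mul2n -addnn exprS exprS exprD !mulrA.
have := qXn N; rewrite exprS => h.
by field.
Qed.

Lemma gauss_recS N n : (n <= N)%N -> jac_ratio N * gauss N.+1 n.+1 =
  (1 + q ^+ (2 * N).+1) * gauss N n.+1 + q ^+ (N - n) * gauss N n
  + q ^+ (N + n).+2 * gauss N n.+2.
Proof.
rewrite leq_eqVlt => /orP[/eqP ->|nN].
  rewrite (@gauss_eq0 N N.+1)// (@gauss_eq0 N N.+2)// gaussSS subnn expr0 /jac_ratio.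
  rewrite !addnn -mul2n; field.
  by rewrite !qXn.
rewrite gaussSS (gaussS N n.+1) (gaussS N n) /jac_ratio.
have [d Nd] : exists d, N = (n + d.+1)%N by exists (N - n.+1)%N; lia.
have -> : (N - n)%N = d.+1 by lia.
have -> : (N - n.+1)%N = d by lia.
have := qXn (N + n.+1); have := qXn (N + n); have := qXn N.
rewrite addnS.
have -> : q ^+ N.+1 = q ^+ 2 * q ^+ n * q ^+ d.
  by rewrite -!exprD; congr (q ^+ _); lia.
have -> : q ^+ (2 * N).+1 = q ^+ 3 * q ^+ n ^+ 2 * q ^+ d ^+ 2.
  by rewrite -!exprM -!exprD; congr (q ^+ _); lia.
have -> : q ^+ (2 * N).+2 = q ^+ 4 * q ^+ n ^+ 2 * q ^+ d ^+ 2.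
  by rewrite -!exprM -!exprD; congr (q ^+ _); lia.
have -> : q ^+ (N + n).+1 = q ^+ 2 * q ^+ n ^+ 2 * q ^+ d.
  by rewrite -!exprM -!exprD; congr (q ^+ _); lia.
have -> : q ^+ (N + n).+2 = q ^+ 3 * q ^+ n ^+ 2 * q ^+ d.
  by rewrite -!exprM -!exprD; congr (q ^+ _); lia.
rewrite [q ^+ d.+1]exprS => h1 h2 h3.
by field; rewrite h1 h3 exprMn h2.
Qed.

Lemma jac_ratio_ge1 N : 1 <= jac_ratio N.
Proof.
rewrite /jac_ratio ler_pdivlMr ?exprn_gt0 ?subr_gt0// mul1r expr2.
by rewrite ler_pM ?subr_ge0 ?qXle// lerB// ler_wiXn2l ?(ltW q0) ?(ltW q1)//; lia.
Qed.

Lemma gauss_nondecreasing n : nondecreasing_seq (gauss ^~ n).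
Proof.
apply/nondecreasing_seqP => N; elim: n => [|n IH]; first by rewrite !gauss0.
rewrite !gaussS ler_pM ?gauss_ge0// ?divr_ge0 ?subr_ge0 ?qXle//.
have [Nn|nN] := leqP N n.
  have -> : (N - n = 0)%N by lia.
  by rewrite expr0 subrr mul0r divr_ge0 ?subr_ge0 ?qXle.
rewrite ler_pdivrMr ?subr_gt0// mulrAC ler_pdivlMr ?subr_gt0//.
have -> : (N.+1 - n = (N - n).+1)%N by lia.
rewrite addSn [q ^+ (N - n).+1]exprS [q ^+ (N + n).+2]exprS.
have : q ^+ (N + n).+1 <= q ^+ (N - n) by rewrite ler_wiXn2l ?(ltW q0) ?(ltW q1)//; lia.
move: (q ^+ (N - n)) (q ^+ (N + n).+1) => x y yx.
rewrite -subr_ge0 (_ : _ - _ = (1 - q) * (x - y)); last by ring.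
by rewrite mulr_ge0 // subr_ge0 // ltW.
Qed.

Lemma gauss_cvg n : gauss N n @[N --> \oo] --> (1 : R).
Proof.
have qc : q ^+ N @[N --> \oo] --> (0 : R).
  by apply: cvg_expr; rewrite ger0_norm ?(ltW q0).
have qc1 k : q ^+ (N - k) @[N --> \oo] --> (0 : R).
  by apply: (cvg_comp (fun N => N - k)%N (fun N => q ^+ N) _ qc); exact: cvg_subnr.
have qc2 k : q ^+ (N + k).+1 @[N --> \oo] --> (0 : R).
  under eq_fun do rewrite -addnS.
  by apply: (cvg_comp (fun N => N + k.+1)%N (fun N => q ^+ N) _ qc); exact: cvg_addnr.
elim: n => [|n IH]; first by under eq_fun do rewrite gauss0; exact: cvg_cst.
under eq_fun do rewrite gaussS.
suff : gauss N n * ((1 - q ^+ (N - n)) / (1 - q ^+ (N + n).+1)) @[N --> \oo] -->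
    (1 * ((1 - 0) / (1 - 0)) : R) by rewrite subr0 divr1 mul1r.
apply: cvgM => //; apply: cvgM; first by apply: cvgB; [exact: cvg_cst|exact: qc1].
apply: cvgV; first by rewrite subr0 oner_neq0.
by apply: cvgB; [exact: cvg_cst|exact: qc2].
Qed.

End JacobiCoefficients.

(** * The Jacobi triple product for the even and odd theta series *)

Lemma geometric_sum_le (R : realType) (s : R) (N : nat) :
  0 <= s -> s < 1 -> \sum_(i < N) s ^+ i <= (1 - s)^-1.
Proof.
move=> s0 s1; rewrite -[leRHS]mul1r ler_pdivlMr ?subr_gt0//.
rewrite (_ : _ * _ = 1 - s ^+ N); first by rewrite gerBl exprn_ge0.
by rewrite -[RHS]opprB subrX1; ring.
Qed.

Definition theta_term (R : realType) (s z : R) (n : int) : R :=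
  s ^ (n * n) * z ^ n.

(** The part of the theta series supported on the integers of the parity of e,
    for e = 0 or 1. The lock keeps unification from unfolding the sums. *)
HB.lock Definition theta_part (R : realType) (e : int) (s z : R) : R :=
  fine (\esum_(a in [set: int]) (theta_term s z (a + a + e))%:E).

Section JacobiTripleProduct.
Variables (R : realType) (s z : R).
Hypotheses (s0 : 0 < s) (s1 : s < 1) (z0 : 0 < z).

Let q := s ^+ 2.
Let q0 : 0 < q. Proof. by rewrite exprn_gt0. Qed.
Let q1 : q < 1. Proof. by rewrite exprn_ilt1 // ltW. Qed.
Let sn0 : s != 0. Proof. by rewrite gt_eqF. Qed.
Let zn0 : z != 0. Proof. by rewrite gt_eqF. Qed.

Lemma theta_term_gt0 n : 0 < theta_term s z n.
Proof. by rewrite mulr_gt0 ?exprz_gt0. Qed.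

Let c (N : nat) (n : int) : R := gauss q N (absz n) * theta_term s z n.

Let c_ge0 N n : 0 <= c N n.
Proof. by rewrite mulr_ge0 ?gauss_ge0 ?ltW ?theta_term_gt0. Qed.

Let c_rec (N : nat) (n : int) :
  jac_ratio q N * c N.+1 n = (1 + s ^+ (4 * N + 2)) * c N n +
    s ^+ (2 * N).+1 * (z * c N (n - 1) + z^-1 * c N (n + 1)).
Proof.
have sE m n' : m = n' -> s ^ m = s ^ n' by move=> ->.
have qE m : q ^+ m = s ^ (2 * m%:Z) by rewrite /q -exprM.
have -> : s ^+ (4 * N + 2) = q ^+ (2 * N).+1.
  by rewrite /q -exprM; congr (s ^+ _); lia.
have e1 : s ^+ (2 * N).+1 * (z * theta_term s z (n - 1)) =
    s ^ (2 * (N%:Z + 1 - n)) * theta_term s z n.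
  rewrite /theta_term exprnP [z ^ (n - 1)]expfzDr//.
  have -> : z * (s ^ ((n - 1) * (n - 1)) * (z ^ n * z ^ (-1))) =
    s ^ ((n - 1) * (n - 1)) * z ^ n.
    by rewrite exprN1; field.
  rewrite !mulrA -!expfzDr//; congr (_ * _); apply: sE; lia.
have e2 : s ^+ (2 * N).+1 * (z^-1 * theta_term s z (n + 1)) =
    s ^ (2 * (N%:Z + 1 + n)) * theta_term s z n.
  rewrite /theta_term exprnP [z ^ (n + 1)]expfzDr//.
  have -> : z^-1 * (s ^ ((n + 1) * (n + 1)) * (z ^ n * z ^ 1)) =
    s ^ ((n + 1) * (n + 1)) * z ^ n.
    by rewrite expr1z; field.
  rewrite !mulrA -!expfzDr//; congr (_ * _); apply: sE; lia.
rewrite /c.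
have -> : s ^+ (2 * N).+1 * (z * (gauss q N (absz (n - 1)) * theta_term s z (n - 1)) +
     z^-1 * (gauss q N (absz (n + 1)) * theta_term s z (n + 1))) =
   (gauss q N (absz (n - 1)) * s ^ (2 * (N%:Z + 1 - n)) +
     gauss q N (absz (n + 1)) * s ^ (2 * (N%:Z + 1 + n))) * theta_term s z n.
  rewrite mulrDl -!mulrA -e1 -e2; ring.
rewrite !mulrA -mulrDl; congr (_ * _).
case: n {e1 e2} => [[|n]|n].
- have -> : absz (0 - 1) = 1%N by []. have -> : absz (0 + 1) = 1%N by []. rewrite [absz 0]/= gauss_rec0// gauss0//.
  have -> : s ^ (2 * (N%:Z + 1 - Posz 0)) = q ^+ N.+1 by rewrite qE; apply: sE; lia.
  ring.
- have -> : absz n.+1 = n.+1 by lia.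
  have -> : absz (Posz n.+1 - 1) = n by lia.
  have -> : absz (Posz n.+1 + 1) = n.+2 by lia.
  have -> : s ^ (2 * (N%:Z + 1 + Posz n.+1)) = q ^+ (N + n).+2.
    by rewrite qE; apply: sE; lia.
  have [nN|Nn] := leqP n N.
    rewrite gauss_recS//.
    have -> : s ^ (2 * (N%:Z + 1 - Posz n.+1)) = q ^+ (N - n).
      by rewrite qE; apply: sE; lia.
    ring.
  by rewrite !gauss_eq0; [ring|lia..].
- have -> : absz (Negz n) = n.+1 by lia.
  have -> : absz (Negz n - 1) = n.+2 by lia.
  have -> : absz (Negz n + 1) = n by lia.
  have -> : s ^ (2 * (N%:Z + 1 - Negz n)) = q ^+ (N + n).+2.
    by rewrite qE; apply: sE; lia.
  have [nN|Nn] := leqP n N.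
    rewrite gauss_recS//.
    have -> : s ^ (2 * (N%:Z + 1 + Negz n)) = q ^+ (N - n).
      by rewrite qE; apply: sE; lia.
    ring.
  by rewrite !gauss_eq0; [ring|lia..].
Qed.

Let U N (e : int) : \bar R := \esum_(a in [set: int]) (c N (a + a + e))%:E.

Let U_shift N : \esum_(a in [set: int]) (c N (a + a - 1))%:E = U N 1.
Proof.
rewrite /U [RHS](reindex_esum [set: int] [set: int] (fun a : int => a - 1)).
  by apply: eq_esum => a _; congr (c N _)%:E; lia.
split=> // [a b _ _ /=|a _]; first by lia.
by exists (a + 1) => //=; lia.
Qed.

Let U_shift2 N : \esum_(a in [set: int]) (c N (a + a + 1 + 1))%:E = U N 0.
Proof.
rewrite /U [RHS](reindex_esum [set: int] [set: int] (fun a : int => a + 1)).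
  by apply: eq_esum => a _; congr (c N _)%:E; lia.
split=> // [a b _ _ /=|a _]; first by lia.
by exists (a - 1) => //=; lia.
Qed.

Let D0 N : 0 < jac_ratio q N.
Proof. by apply: lt_le_trans (jac_ratio_ge1 q0 q1 N). Qed.

Let U_rec N (e : int) (f1 f2 : int -> int) (V : \bar R) :
  (forall a, a + a + e - 1 = f1 a) -> (forall a, a + a + e + 1 = f2 a) ->
  (\esum_(a in [set: int]) (c N (f1 a))%:E = V)%E ->
  (\esum_(a in [set: int]) (c N (f2 a))%:E = V)%E ->
  ((jac_ratio q N)%:E * U N.+1 e =
   (1 + s ^+ (4 * N + 2))%:E * U N e + (s ^+ (2 * N).+1 * z)%:E * V
   + (s ^+ (2 * N).+1 * z^-1)%:E * V)%E.
Proof.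
move=> h1 h2 V1 V2.
have p1 : 0 < 1 + s ^+ (4 * N + 2) by rewrite addr_gt0 ?exprn_gt0.
have p2 : 0 < s ^+ (2 * N).+1 * z by rewrite mulr_gt0 ?exprn_gt0.
have p3 : 0 < s ^+ (2 * N).+1 * z^-1 by rewrite mulr_gt0 ?exprn_gt0 ?invr_gt0.
rewrite -{1}V1 -V2 /U -!esumZl//; try by move=> *; rewrite lee_fin c_ge0.
rewrite -!esumD; try by move=> *; rewrite ?adde_ge0 ?mule_ge0 ?lee_fin ?c_ge0 ?ltW.
apply: eq_esum => a _; rewrite -!EFinM -!EFinD c_rec -h1 -h2; congr (_%:E).
ring.
Qed.

Let t := z + z^-1.

Let triple_finite N : exists ev od : R,
  [/\ U N 0 = ev%:E, U N 1 = od%:E,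
  (\prod_(i < N) jac_ratio q i) * (ev + od) =
    \prod_(i < N) (1 + s ^+ (4 * i + 2) + s ^+ (2 * i).+1 * t) &
  (\prod_(i < N) jac_ratio q i) * (ev - od) =
    \prod_(i < N) (1 + s ^+ (4 * i + 2) - s ^+ (2 * i).+1 * t)].
Proof.
elim: N => [|N [ev [od [hev hod hp hm]]]].
  exists 1, 0; split; rewrite ?big_ord0 ?mul1r ?addr0 ?subr0//.
    rewrite /U -(@esum_set1 _ _ (0 : int) (fun=> 1%:E)) ?lee_fin//.
    rewrite [RHS]esum_mkcond; apply: eq_esum => a _.
    have [->|a0] := eqVneq a 0.
      by rewrite mem_set// /c /theta_term gauss0 !mul1r.
    rewrite memNset/=; last by move/eqP: a0.
    by rewrite /c gauss_eq0 ?mul0r//; lia.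
  rewrite /U esum1// => a _; rewrite /c gauss_eq0 ?mul0r//; lia.
have rev : ((jac_ratio q N)%:E * U N.+1 0 = _)%E :=
  @U_rec N 0 (fun a => a + a - 1) (fun a => a + a + 1) (U N 1)
    ltac:(move=> a; lia) ltac:(move=> a; lia) (U_shift N) erefl.
have rod : ((jac_ratio q N)%:E * U N.+1 1 = _)%E :=
  @U_rec N 1 (fun a => a + a + 0) (fun a => a + a + 1 + 1) (U N 0)
    ltac:(move=> a; lia) ltac:(move=> a; lia) erefl (U_shift2 N).
have Dn0 : jac_ratio q N != 0 by rewrite gt_eqF.
have cancel x y : ((jac_ratio q N)%:E * x = y%:E)%E -> x = (y / jac_ratio q N)%:E.
  move=> h; have := congr1 (fun x => ((jac_ratio q N)^-1%:E * x)%E) h.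
  by rewrite muleA -!EFinM mulVf// mul1e mulrC.
rewrite hev hod -!EFinM -!EFinD in rev; have {}rev := cancel _ _ rev.
rewrite hev hod -!EFinM -!EFinD in rod; have {}rod := cancel _ _ rod.
eexists; eexists; split; [exact: rev|exact: rod| |].
  rewrite !big_ord_recr/= -hp /t; field.
  by rewrite Dn0 zn0.
rewrite !big_ord_recr/= -hm /t; field.
by rewrite Dn0 zn0.
Qed.

Let t0 : 0 < t. Proof. by rewrite addr_gt0 ?invr_gt0. Qed.

Let triple_bound N :
  \prod_(i < N) (1 + s ^+ (4 * i + 2) + s ^+ (2 * i).+1 * t) <=
  expR ((1 + t) / (1 - s)).
Proof.
apply: (@le_trans _ _ (\prod_(i < N) expR ((1 + t) * s ^+ i))).
  apply: ler_prod => i _; apply/andP; split.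
    by rewrite !addr_ge0 ?mulr_ge0 ?exprn_ge0 ?(ltW t0) ?(ltW s0).
  apply: le_trans (expR_ge1Dx _); rewrite -addrA lerD2l mulrDl mul1r.
  have le_pow m : (i <= m)%N -> s ^+ m <= s ^+ i.
    by move=> im; rewrite ler_wiXn2l ?(ltW s0) ?(ltW s1).
  rewrite lerD//; first by apply: le_pow; lia.
  by rewrite mulrC ler_wpM2l ?(ltW t0)// le_pow//; lia.
rewrite -expR_sum ler_expR -mulr_sumr ler_pM2l ?addr_gt0 ?invr_gt0//.
exact: geometric_sum_le (ltW s0) s1.
Qed.

Lemma jac_prod_gt0 N : 0 < \prod_(i < N) jac_ratio q i.
Proof. by apply: prodr_gt0. Qed.

Let jac_prod_ge1 N : 1 <= \prod_(i < N) jac_ratio q i.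
Proof.
elim: N => [|N IH]; first by rewrite big_ord0.
by rewrite big_ord_recr/= mulr_ege1// jac_ratio_ge1.
Qed.

Let U_bound N : (U N 0 + U N 1 <= (expR ((1 + t) / (1 - s)))%:E)%E.
Proof.
have [ev [od [hev hod hp _]]] := triple_finite N.
rewrite hev hod -EFinD lee_fin; apply: le_trans (triple_bound N); rewrite -hp.
rewrite ler_peMl// addr_ge0// -lee_fin -?hev -?hod;
  by apply: esum_ge0 => a _; rewrite lee_fin.
Qed.

Let U_cvg e : U N e @[N --> \oo] -->
  \esum_(a in [set: int]) (theta_term s z (a + a + e))%:E.
Proof.
apply: esum_monotone_cvg => [N a|a M N MN|a]; first exact: c_ge0.
  by rewrite ler_wpM2r ?(ltW (theta_term_gt0 _))// gauss_nondecreasing.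
rewrite -[X in _ --> X]mul1r.
by apply: cvgM; [exact: gauss_cvg|exact: cvg_cst].
Qed.

Let U_ge0 N e : (0 <= U N e)%E.
Proof. by apply: esum_ge0 => a _; rewrite lee_fin. Qed.

Let theta_fin (e : int) : e = 0 \/ e = 1 ->
  \esum_(a in [set: int]) (theta_term s z (a + a + e))%:E = (theta_part e s z)%:E.
Proof.
move=> he; rewrite theta_part.unlock fineK// ge0_fin_numE; last first.
  by apply: esum_ge0 => a _; rewrite lee_fin (ltW (theta_term_gt0 _)).
apply: (@le_lt_trans _ _ (expR ((1 + t) / (1 - s)))%:E); last exact: ltry.
rewrite -(cvg_lim _ (@U_cvg e))//; apply: lime_le.
  by apply/cvg_ex; eexists; exact: U_cvg.
apply: nearW => N; apply: le_trans (U_bound N).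
by case: he => ->; [rewrite leeDl|rewrite leeDr].
Qed.

Lemma theta_evenE :
  \esum_(a in [set: int]) (theta_term s z (a + a))%:E = (theta_part 0 s z)%:E.
Proof.
by rewrite -theta_fin; [apply: eq_esum => a _; rewrite addr0|left].
Qed.

Lemma theta_oddE :
  \esum_(a in [set: int]) (theta_term s z (a + a + 1))%:E = (theta_part 1 s z)%:E.
Proof. by rewrite -theta_fin; last right. Qed.

(** The finite products satisfy the recurrence of the normalized Gaussian
    coefficients, which increase to 1; the partial sums over even and odd
    integers therefore increase to the two theta series. Taking the half sum and
    the half difference of the products with signs + and - separates the two
    parities, so that only series with positive terms occur. *)
Lemma jacobi_triple_product : exists ev od : nat -> R,
  [/\ ev N @[N --> \oo] --> theta_part 0 s z,
      od N @[N --> \oo] --> theta_part 1 s z,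
      forall N, (\prod_(i < N) jac_ratio (s ^+ 2) i) * (ev N + od N) =
        \prod_(i < N) (1 + s ^+ (4 * i + 2) + s ^+ (2 * i).+1 * (z + z^-1)) &
      forall N, (\prod_(i < N) jac_ratio (s ^+ 2) i) * (ev N - od N) =
        \prod_(i < N) (1 + s ^+ (4 * i + 2) - s ^+ (2 * i).+1 * (z + z^-1))].
Proof.
exists (fun N => fine (U N 0)), (fun N => fine (U N 1)); split.
- by apply: fine_cvg; rewrite -theta_fin; [exact: U_cvg|left].
- by apply: fine_cvg; rewrite -theta_fin; [exact: U_cvg|right].
- by move=> N; have [ev [od [-> -> h _]]] := triple_finite N.
- by move=> N; have [ev [od [-> -> _ h]]] := triple_finite N.
Qed.

Lemma theta_even_ge1 : 1 <= theta_part 0 s z.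
Proof.
rewrite -lee_fin -theta_evenE.
rewrite [leLHS](_ : _ = (theta_term s z (0 + 0))%:E); last first.
  by rewrite /theta_term mulr1.
apply: esum_ge; exists [set 0]; first by split=> //; exact: finite_set1.
by rewrite fsbig_set1.
Qed.

Lemma theta_odd_gt0 : 0 < theta_part 1 s z.
Proof.
rewrite -lte_fin -theta_oddE.
apply: (@lt_le_trans _ _ (theta_term s z (0 + 0 + 1))%:E).
  by rewrite lte_fin theta_term_gt0.
apply: esum_ge; exists [set 0]; first by split=> //; exact: finite_set1.
by rewrite fsbig_set1.
Qed.

End JacobiTripleProduct.

(** * Products of two theta series *)

Section ThetaAddition.
Variables (R : realType) (s z al : R).
Hypotheses (s0 : 0 < s) (s1 : s < 1) (z0 : 0 < z) (al0 : 0 < al).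

Let s20 : 0 < s ^+ 2. Proof. by rewrite exprn_gt0. Qed.
Let s21 : s ^+ 2 < 1. Proof. by rewrite exprn_ilt1 // ltW. Qed.
Let za0 : 0 < z * al. Proof. exact: mulr_gt0. Qed.
Let zd0 : 0 < z / al. Proof. exact: divr_gt0. Qed.

Let theta_termM m n :
  theta_term (s ^+ 2) (z * al) m * theta_term (s ^+ 2) (z / al) n =
  theta_term s z (m + n) * theta_term s al (m - n).
Proof.
have sn0 : s != 0 by rewrite gt_eqF.
have zn0 : z != 0 by rewrite gt_eqF.
have an0 : al != 0 by rewrite gt_eqF.
have sE k : (s ^+ 2) ^ k = s ^ (k + k) by rewrite expfzDr// -expfzMl.
rewrite /theta_term !sE [(z * al) ^ m]expfzMl [(z / al) ^ n]expfzMl.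
rewrite [z ^ (m + n)]expfzDr// [al ^ (m - n)]expfzDr// exprz_inv.
transitivity (s ^ (m * m + m * m) * s ^ (n * n + n * n) *
   (z ^ m * z ^ n) * (al ^ m * al ^ (- n))); first by ring.
transitivity (s ^ ((m + n) * (m + n)) * s ^ ((m - n) * (m - n)) *
   (z ^ m * z ^ n) * (al ^ m * al ^ (- n))); last by ring.
do 2!congr (_ * _); rewrite -!expfzDr//; congr (s ^ _); lia.
Qed.

Let tt_gt0 := theta_term_gt0.

(** In the double series for nome s^2 the exponents satisfy
    2 m^2 + 2 n^2 = (m + n)^2 + (m - n)^2, and m + n and m - n are both even
    exactly when m and n have the same parity. *)
Lemma theta_add_even :
  theta_part 0 (s ^+ 2) (z * al) * theta_part 0 (s ^+ 2) (z / al) +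
  theta_part 1 (s ^+ 2) (z * al) * theta_part 1 (s ^+ 2) (z / al) =
  theta_part 0 s z * theta_part 0 s al.
Proof.
apply: EFin_inj; rewrite EFinD.
rewrite -(esum_mul _ _ (theta_evenE s20 s21 za0) (theta_evenE s20 s21 zd0));
  try by move=> *; exact: tt_gt0.
rewrite -(esum_mul _ _ (theta_oddE s20 s21 za0) (theta_oddE s20 s21 zd0));
  try by move=> *; exact: tt_gt0.
rewrite -(esum_mul _ _ (theta_evenE s0 s1 z0) (theta_evenE s0 s1 al0));
  try by move=> *; exact: tt_gt0.
rewrite [RHS]esum_int2_parity; last first.
  by move=> p; rewrite lee_fin mulr_ge0// ltW// tt_gt0.
congr (_ + _)%E; apply: eq_esum => -[a c] _ /=; rewrite theta_termM;
  congr (theta_term s z _ * theta_term s al _)%:E; lia.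
Qed.

(** Pairs of opposite parity correspond to m + n and m - n both odd. The families
    (odd, even) and (even, odd) give the two cosets of the lattice, the second
    one after a translation of its even index. *)
Lemma theta_add_odd :
  theta_part 1 (s ^+ 2) (z * al) * theta_part 0 (s ^+ 2) (z / al) +
  theta_part 0 (s ^+ 2) (z * al) * theta_part 1 (s ^+ 2) (z / al) =
  theta_part 1 s z * theta_part 1 s al.
Proof.
apply: EFin_inj; rewrite EFinD.
(* the even part, indexed by a + 1 *)
have even_shift : \esum_(a in [set: int])
    (theta_term (s ^+ 2) (z * al) (a + 1 + (a + 1)))%:E =
    (theta_part 0 (s ^+ 2) (z * al))%:E.
  rewrite -theta_evenE// [RHS](reindex_esum [set: int] [set: int] (+%R^~ 1))//.
  split=> // [a b _ _ /=|a _]; first by lia.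
  by exists (a - 1) => //=; lia.
rewrite -(esum_mul _ _ (theta_oddE s20 s21 za0) (theta_evenE s20 s21 zd0));
  try by move=> *; exact: tt_gt0.
rewrite -(esum_mul _ _ even_shift (theta_oddE s20 s21 zd0));
  try by move=> *; exact: tt_gt0.
rewrite -(esum_mul _ _ (theta_oddE s0 s1 z0) (theta_oddE s0 s1 al0));
  try by move=> *; exact: tt_gt0.
rewrite [RHS]esum_int2_parity; last first.
  by move=> p; rewrite lee_fin mulr_ge0// ltW// tt_gt0.
congr (_ + _)%E; apply: eq_esum => -[a c] _ /=; rewrite theta_termM;
  congr (theta_term s z _ * theta_term s al _)%:E; lia.
Qed.

End ThetaAddition.

(** * The theta quotient, its symmetries and its addition theorem *)

Definition theta_ratio (R : realType) (s z : R) : R :=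
  theta_part 1 s z / theta_part 0 s z.

Definition theta_quot (R : realType) (s z : R) : R :=
  (1 - theta_ratio s z) / (1 + theta_ratio s z).

Definition theta_factor (R : realType) (b t : R) : R :=
  (1 + b ^+ 2 - b * t) / (1 + b ^+ 2 + b * t).

Section ThetaQuotient.
Variables (R : realType) (s : R).
Hypotheses (s0 : 0 < s) (s1 : s < 1).

Lemma theta_even_gt0 z : 0 < z -> 0 < theta_part 0 s z.
Proof. by move=> z0; apply: lt_le_trans (theta_even_ge1 s0 s1 z0). Qed.

Lemma theta_ratio_gt0 z : 0 < z -> 0 < theta_ratio s z.
Proof.
by move=> z0; apply: divr_gt0; [exact: theta_odd_gt0|exact: theta_even_gt0].
Qed.

Lemma theta_quotE z : 0 < z -> theta_quot s z =
  (theta_part 0 s z - theta_part 1 s z) / (theta_part 0 s z + theta_part 1 s z).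
Proof.
move=> z0; have e0 := theta_even_gt0 z0; have o0 := theta_odd_gt0 s0 s1 z0.
rewrite /theta_quot /theta_ratio.
move: (theta_part 0 s z) (theta_part 1 s z) e0 o0 => x y x0 y0; field.
by apply/andP; split; rewrite gt_eqF// addr_gt0.
Qed.

Lemma theta_ratioE z : 0 < z ->
  theta_ratio s z = (1 - theta_quot s z) / (1 + theta_quot s z).
Proof.
move=> z0; have x0 := theta_ratio_gt0 z0; rewrite /theta_quot.
move: (theta_ratio s z) x0 => x x0.
have x1 : 1 + x != 0 by apply: lt0r_neq0; apply: addr_gt0.
field; rewrite x1 (_ : _ + _ = 2); first by rewrite pnatr_eq0.
by ring.
Qed.

(** Quotient of the two finite products with signs - and +: the normalizing
    central coefficients cancel. *)
Lemma theta_quot_cvg z : 0 < z ->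
  \prod_(i < N) theta_factor (s ^+ (2 * i).+1) (z + z^-1) @[N --> \oo]
    --> theta_quot s z.
Proof.
move=> z0; rewrite theta_quotE//.
have [ev [od [hev hod hp hm]]] := jacobi_triple_product s0 s1 z0.
have C0 N : 0 < \prod_(i < N) jac_ratio (s ^+ 2) i by exact: jac_prod_gt0.
have -> : (fun N => \prod_(i < N) theta_factor (s ^+ (2 * i).+1) (z + z^-1)) =
    (fun N => (ev N - od N) / (ev N + od N)).
  apply/funext => N; rewrite /theta_factor big_split/= prodfV.
  have e (i : nat) : (s ^+ (2 * i).+1) ^+ 2 = s ^+ (4 * i + 2).
    by rewrite -exprM; congr (_ ^+ _); lia.
  under eq_bigr do rewrite e.
  under [X in _ * X^-1]eq_bigr do rewrite e.
  rewrite -hp -hm invfM mulrACA mulfV ?mul1r// gt_eqF//.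
apply: cvgM; first exact: cvgB.
apply: cvgV; last exact: cvgD.
by rewrite gt_eqF// addr_gt0 ?theta_even_gt0 ?theta_odd_gt0.
Qed.

Lemma theta_quotV z : 0 < z -> theta_quot s z^-1 = theta_quot s z.
Proof.
move=> z0; have z0' : 0 < z^-1 by rewrite invr_gt0.
have := theta_quot_cvg z0'; rewrite invrK addrC => /cvg_lim <-//.
by rewrite (cvg_lim _ (theta_quot_cvg z0)).
Qed.

Lemma theta_ratioV z : 0 < z -> theta_ratio s z^-1 = theta_ratio s z.
Proof. by move=> z0; rewrite !theta_ratioE ?invr_gt0// theta_quotV. Qed.

(** Completing the square in s^(n^2 + 2n) moves n to n + 1, hence exchanges the
    even and the odd part. *)
Lemma theta_ratio_shift z : 0 < z ->
  theta_ratio s (s ^+ 2 * z) = (theta_ratio s z)^-1.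
Proof.
move=> z0.
have sz0 : 0 < s ^+ 2 * z by rewrite mulr_gt0 ?exprn_gt0.
have sn0 : s != 0 by rewrite gt_eqF.
have zn0 : z != 0 by rewrite gt_eqF.
have c0 : 0 < (s * z)^-1 by rewrite invr_gt0 mulr_gt0.
have termE n : theta_term s (s ^+ 2 * z) n = (s * z)^-1 * theta_term s z (n + 1).
  rewrite /theta_term expfzMl [z ^ (n + 1)]expfzDr// expr1z.
  have -> : (s ^+ 2) ^ n = s ^ (n + n) by rewrite expfzDr// -expfzMl.
  have -> : (n + 1) * (n + 1) = n * n + (n + n) + 1 by ring.
  by rewrite !expfzDr// expr1z; field; rewrite sn0 zn0.
have t0 n : (0 <= (theta_term s z n)%:E)%E by rewrite lee_fin ltW// theta_term_gt0.
have e0 : theta_part 0 s (s ^+ 2 * z) = (s * z)^-1 * theta_part 1 s z.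
  apply: EFin_inj; rewrite -theta_evenE// EFinM -theta_oddE// -esumZl//.
  by apply: eq_esum => a _; rewrite termE.
have e1 : theta_part 1 s (s ^+ 2 * z) = (s * z)^-1 * theta_part 0 s z.
  apply: EFin_inj; rewrite -theta_oddE// EFinM -theta_evenE// -esumZl//.
  rewrite [RHS](reindex_esum [set: int] [set: int] (+%R^~ 1)).
    apply: eq_esum => a _; rewrite termE EFinM; congr (_ * (theta_term s z _)%:E)%E.
    by lia.
  split=> // [a b _ _ /=|a _]; first by lia.
  by exists (a - 1) => //=; lia.
rewrite /theta_ratio e0 e1.
have := theta_even_gt0 z0; have := theta_odd_gt0 s0 s1 z0.
move: (theta_part 0 s z) (theta_part 1 s z) => x y y0 x0; field.
by apply/and4P; split=> //; exact: lt0r_neq0.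
Qed.

Lemma theta_quot_shift z : 0 < z -> theta_quot s (s ^+ 2 * z) = - theta_quot s z.
Proof.
move=> z0; rewrite /theta_quot theta_ratio_shift//.
have := theta_ratio_gt0 z0; move: (theta_ratio s z) => x x0; field.
by rewrite (lt0r_neq0 x0) lt0r_neq0//; apply: addr_gt0.
Qed.

End ThetaQuotient.

Lemma theta_ratio_add (R : realType) (s z al : R) :
  0 < s -> s < 1 -> 0 < z -> 0 < al ->
  theta_ratio s z * theta_ratio s al =
  (theta_ratio (s ^+ 2) (z * al) + theta_ratio (s ^+ 2) (z / al)) /
  (1 + theta_ratio (s ^+ 2) (z * al) * theta_ratio (s ^+ 2) (z / al)).
Proof.
move=> s0 s1 z0 al0.
have s20 : 0 < s ^+ 2 by rewrite exprn_gt0.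
have s21 : s ^+ 2 < 1 by rewrite exprn_ilt1 // ltW.
have za0 : 0 < z * al by exact: mulr_gt0.
have zd0 : 0 < z / al by exact: divr_gt0.
rewrite /theta_ratio mulf_div -theta_add_odd// -theta_add_even//.
have := theta_even_gt0 s20 s21 za0; have := theta_odd_gt0 s20 s21 za0.
have := theta_even_gt0 s20 s21 zd0; have := theta_odd_gt0 s20 s21 zd0.
move: (theta_part _ _ _) (theta_part _ _ _) (theta_part _ _ _) (theta_part _ _ _).
move=> a a' b b' a0 a'0 b0 b'0; field.
by apply/and3P; split; apply: lt0r_neq0; rewrite ?addr_gt0 ?mulr_gt0.
Qed.

Lemma theta_quot_add (R : realType) (s z al : R) :
  0 < s -> s < 1 -> 0 < z -> 0 < al ->
  theta_quot (s ^+ 2) (z * al) * theta_quot (s ^+ 2) (z / al) =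
  (1 - theta_ratio s z * theta_ratio s al) / (1 + theta_ratio s z * theta_ratio s al).
Proof.
move=> s0 s1 z0 al0.
have s20 : 0 < s ^+ 2 by rewrite exprn_gt0.
have s21 : s ^+ 2 < 1 by rewrite exprn_ilt1 // ltW.
rewrite theta_ratio_add// /theta_quot.
have := theta_ratio_gt0 s20 s21 (mulr_gt0 z0 al0).
have := theta_ratio_gt0 s20 s21 (divr_gt0 z0 al0).
move: (theta_ratio _ _) (theta_ratio _ _) => a b a0 b0; field.
by rewrite !gt_eqF ?addr_gt0 ?mulr_gt0.
Qed.

(** * Bounds, continuity and monotonicity of the theta quotient *)

Section ThetaFactor.
Variable R : realType.
Implicit Types b t u z : R.

Lemma theta_factor_den b t : 0 <= b -> 0 <= t -> 0 < 1 + b ^+ 2 + b * t.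
Proof.
by move=> b0 t0; rewrite -addrA ltr_wpDr ?addr_ge0 ?exprn_ge0 ?mulr_ge0.
Qed.

Lemma theta_factor_le1 b t : 0 <= b -> 0 <= t -> `|theta_factor b t| <= 1.
Proof.
move=> b0 t0; have d0 := theta_factor_den b0 t0.
rewrite normrM normfV (gtr0_norm d0) ler_pdivrMr// mul1r ler_norml.
have bt : 0 <= b * t by rewrite mulr_ge0.
have b2 : 0 <= b ^+ 2 by rewrite exprn_ge0.
by apply/andP; split; lra.
Qed.

(** For nonnegative t the derivative of the factor is at most 2 b in absolute
    value. *)
Lemma theta_factor_lip b t u : 0 <= b -> 0 <= t -> 0 <= u ->
  `|theta_factor b t - theta_factor b u| <= 2 * b * `|t - u|.
Proof.
move=> b0 t0 u0; have dt := theta_factor_den b0 t0.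
have du := theta_factor_den b0 u0.
have -> : theta_factor b t - theta_factor b u = 2 * b * (u - t) *
    ((1 + b ^+ 2) / ((1 + b ^+ 2 + b * t) * (1 + b ^+ 2 + b * u))).
  by rewrite /theta_factor; field; rewrite !gt_eqF.
rewrite normrM (_ : `|2 * b * (u - t)| = 2 * b * `|t - u|); last first.
  by rewrite normrM distrC ger0_norm ?mulr_ge0.
rewrite ler_piMr ?mulr_ge0//.
have bt : 0 <= b * t by rewrite mulr_ge0.
have bu : 0 <= b * u by rewrite mulr_ge0.
have b2 : 0 <= b ^+ 2 by rewrite exprn_ge0.
rewrite ger0_norm ?divr_ge0 ?mulr_ge0 ?(ltW dt) ?(ltW du) ?addr_ge0//.
rewrite ler_pdivrMr ?mulr_gt0// mul1r.
apply: (@le_trans _ _ ((1 + b ^+ 2) * 1)); first by rewrite mulr1.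
by apply: ler_pM; rewrite ?addr_ge0//; lra.
Qed.

Lemma theta_factor_ge0 b z : 0 < b -> b <= z -> z <= b^-1 ->
  0 <= theta_factor b (z + z^-1).
Proof.
move=> b0 bz zb; have z0 : 0 < z by apply: lt_le_trans bz.
rewrite divr_ge0//; last first.
  by rewrite ltW// theta_factor_den// ?ltW// addr_gt0 ?invr_gt0.
have -> : 1 + b ^+ 2 - b * (z + z^-1) = (1 - b * z) * (1 - b / z).
  by field; rewrite gt_eqF.
rewrite mulr_ge0// subr_ge0.
  by rewrite mulrC -ler_pdivlMr// mul1r.
by rewrite ler_pdivrMr// mul1r.
Qed.

Lemma theta_factor_decr b t u : 0 <= b -> 0 <= t -> t <= u ->
  theta_factor b u <= theta_factor b t.
Proof.
move=> b0 t0 tu; have u0 := le_trans t0 tu.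
rewrite /theta_factor ler_pdivrMr ?theta_factor_den// mulrAC ler_pdivlMr ?theta_factor_den//.
rewrite -subr_ge0 (_ : _ - _ = 2 * (b * ((1 + b ^+ 2) * (u - t)))); last by ring.
by rewrite !mulr_ge0 ?subr_ge0 ?addr_ge0 ?exprn_ge0.
Qed.

Lemma theta_factor_decr_strict b t u : 0 < b -> 0 <= t -> t < u ->
  theta_factor b u < theta_factor b t.
Proof.
move=> b0 t0 tu; have u0 := le_trans t0 (ltW tu).
have du := theta_factor_den (ltW b0) u0; have dt := theta_factor_den (ltW b0) t0.
rewrite /theta_factor ltr_pdivrMr// mulrAC ltr_pdivlMr//.
rewrite -subr_gt0 (_ : _ - _ = 2 * (b * ((1 + b ^+ 2) * (u - t)))); last by ring.
by rewrite !mulr_gt0 ?subr_gt0// ltr_wpDr ?exprn_ge0 ?ltW.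
Qed.

End ThetaFactor.

(** Telescoping: exchange the factors one at a time. *)
Lemma prod_lipschitz (R : realType) (N : nat) (f g : nat -> R) :
  (forall i, `|f i| <= 1) -> (forall i, `|g i| <= 1) ->
  `|\prod_(i < N) f i - \prod_(i < N) g i| <= \sum_(i < N) `|f i - g i|.
Proof.
move=> f1 g1; elim: N => [|N IH]; first by rewrite !big_ord0 subrr normr0.
rewrite !big_ord_recr/=.
rewrite (_ : _ - _ = (\prod_(i < N) f i - \prod_(i < N) g i) * f N +
   (\prod_(i < N) g i) * (f N - g N)); last by ring.
apply: le_trans (ler_normD _ _) _; rewrite !normrM lerD//.
  by apply: le_trans IH; rewrite ler_piMr.
rewrite ler_piMl// normr_prod; apply: prodr_ile1 => i _.
by rewrite normr_ge0 g1.
Qed.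

Section ThetaQuotientBounds.
Variables (R : realType) (s : R).
Hypotheses (s0 : 0 < s) (s1 : s < 1).

Let b (i : nat) := s ^+ (2 * i).+1.
Let b0 i : 0 < b i. Proof. exact: exprn_gt0. Qed.
Let b_le i : b i <= s ^+ i.
Proof. by rewrite ler_wiXn2l ?(ltW s0) ?(ltW s1)//; lia. Qed.
Let b_les i : b i <= s.
Proof. by rewrite /b exprS ler_piMr ?(ltW s0)// exprn_ile1 ?ltW. Qed.

Let t_ge2 (z : R) : 0 < z -> 2 <= z + z^-1.
Proof.
move=> z0; rewrite -subr_ge0 (_ : _ - _ = (z - 1) ^+ 2 / z).
  by rewrite divr_ge0 ?sqr_ge0 ?ltW.
by field; rewrite gt_eqF.
Qed.

Lemma theta_quot_lipschitz (z w : R) : 0 < z -> 0 < w ->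
  `|theta_quot s z - theta_quot s w| <= 2 / (1 - s) * `|z + z^-1 - (w + w^-1)|.
Proof.
move=> z0 w0; have tz := t_ge2 z0; have tw := t_ge2 w0.
have h : `|\prod_(i < N) theta_factor (b i) (z + z^-1) -
    \prod_(i < N) theta_factor (b i) (w + w^-1)| @[N --> \oo] -->
    `|theta_quot s z - theta_quot s w|.
  by apply: cvg_norm; apply: cvgB; exact: theta_quot_cvg.
rewrite -(cvg_lim _ h)//; apply: limr_le; first by apply/cvg_ex; eexists; exact: h.
apply: nearW => N /=.
have [tz0 tw0] : 0 <= z + z^-1 /\ 0 <= w + w^-1 by split; lra.
apply: le_trans.
  apply: (@prod_lipschitz _ N (fun i => theta_factor (b i) (z + z^-1))
    (fun i => theta_factor (b i) (w + w^-1))) => i;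
  exact: theta_factor_le1 (ltW (b0 i)) _.
apply: (@le_trans _ _ (\sum_(i < N) (2 * `|z + z^-1 - (w + w^-1)|) * s ^+ i)).
  apply: ler_sum => i _; apply: le_trans (theta_factor_lip (ltW (b0 i)) tz0 tw0) _.
  by rewrite mulrAC ler_wpM2l ?mulr_ge0.
rewrite -mulr_sumr [leRHS]mulrAC ler_wpM2l ?mulr_ge0//.
exact: geometric_sum_le (ltW s0) s1.
Qed.

Let factor_ge0 z i : s <= z -> z <= s^-1 -> 0 <= theta_factor (b i) (z + z^-1).
Proof.
move=> sz zs; apply: theta_factor_ge0 => //; first exact: le_trans (b_les i) sz.
by apply: le_trans zs _; rewrite lef_pV2 ?posrE ?b_les ?b0.
Qed.

Lemma theta_quot_ge0 z : s <= z -> z <= s^-1 -> 0 <= theta_quot s z.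
Proof.
move=> sz zs; have z0 := lt_le_trans s0 sz.
have h := theta_quot_cvg s0 s1 z0.
rewrite -(cvg_lim _ h)//; apply: limr_ge; first by apply/cvg_ex; eexists; exact: h.
by apply: nearW => N; apply: prodr_ge0 => i _; exact: factor_ge0.
Qed.

Lemma theta_quot_decr z w : s <= z -> z <= s^-1 -> s <= w -> w <= s^-1 ->
  z + z^-1 <= w + w^-1 -> theta_quot s w <= theta_quot s z.
Proof.
move=> sz zs sw ws tzw.
have z0 := lt_le_trans s0 sz; have w0 := lt_le_trans s0 sw.
have hz := theta_quot_cvg s0 s1 z0; have hw := theta_quot_cvg s0 s1 w0.
rewrite -(cvg_lim _ hz)// -(cvg_lim _ hw)//; apply: ler_lim.
- by apply/cvg_ex; eexists; exact: hw.
- by apply/cvg_ex; eexists; exact: hz.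
apply: nearW => N; apply: ler_prod => i _; rewrite factor_ge0//=.
by apply: theta_factor_decr (ltW (b0 i)) _ tzw; have := t_ge2 z0; lra.
Qed.

Lemma theta_quot_le1 z : s <= z -> z <= s^-1 -> theta_quot s z <= theta_quot s 1.
Proof.
move=> sz zs; have z0 := lt_le_trans s0 sz.
apply: theta_quot_decr; rewrite ?(ltW s1)//.
  by rewrite invf_ge1// ltW.
by rewrite invr1; exact: t_ge2.
Qed.

(** On [s, 1/s] every factor of the product is nonnegative and largest at z = 1;
    the rest of the half line is reached by multiplying by s^2, which only
    changes the sign. *)
Lemma theta_quot_norm_le n z : s <= z -> z <= s^-1 * s ^- (2 * n) ->
  `|theta_quot s z| <= theta_quot s 1.
Proof.
elim: n z => [|n IH] z sz.
  rewrite muln0 expr0 invr1 mulr1 => zs; rewrite ger0_norm ?theta_quot_ge0// theta_quot_le1//.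
have z0 := lt_le_trans s0 sz; move=> zn.
have [zs|sz'] := leP z s^-1.
  by rewrite ger0_norm ?theta_quot_ge0// theta_quot_le1//.
rewrite -normrN -theta_quot_shift//; apply: IH.
  rewrite expr2 -mulrA ler_peMr ?(ltW s0)// ltW//.
  by rewrite mulrC -ltr_pdivrMr// div1r.
rewrite mulrC -ler_pdivlMr ?exprn_gt0//; apply: le_trans zn _.
by rewrite mulnS addnC exprD invfM mulrA.
Qed.

(** A product of factors in ]0, 1] could still converge to 0; the inverse of the
    factor for b is at most exp(2 b t / d) with a common d > 0, and the b are
    summable. *)
Lemma theta_quot_gt0 z : s < z -> z < s^-1 -> 0 < theta_quot s z.
Proof.
move=> sz zs; have z0 := lt_trans s0 sz; have tz := t_ge2 z0.
pose d := (1 - s * z) * (1 - s / z).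
have sz1 : s * z < 1 by rewrite mulrC -ltr_pdivlMr// div1r.
have sz2 : s / z < 1 by rewrite ltr_pdivrMr// mul1r.
have d0 : 0 < d by rewrite mulr_gt0 ?subr_gt0.
pose t := z + z^-1; have t0 : 0 < t by rewrite /t; lra.
have h := theta_quot_cvg s0 s1 z0.
apply: (@lt_le_trans _ _ (expR (- (2 * t / d / (1 - s))))); first exact: expR_gt0.
rewrite -(cvg_lim _ h)//; apply: limr_ge; first by apply/cvg_ex; eexists; exact: h.
apply: nearW => N.
apply: (@le_trans _ _ (\prod_(i < N) expR (- (2 * t / d * s ^+ i)))).
  rewrite -expR_sum ler_expR sumrN lerN2 -mulr_sumr ler_wpM2l//.
    by apply: divr_ge0; [apply: mulr_ge0 => //|]; exact: ltW.
  exact: geometric_sum_le (ltW s0) s1.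
apply: ler_prod => i _; rewrite expR_ge0/=.
pose num := 1 + b i ^+ 2 - b i * t.
have numE : num = (1 - b i * z) * (1 - b i / z).
  by rewrite /num /t; field; rewrite gt_eqF.
have dnum : d <= num.
  rewrite numE /d; apply: ler_pM; rewrite ?subr_ge0 ?(ltW sz1) ?(ltW sz2)//.
    by rewrite lerD2l lerN2 ler_wpM2r ?(ltW z0)// b_les.
  by rewrite lerD2l lerN2 ler_wpM2r ?invr_ge0 ?(ltW z0)// b_les.
have num0 : 0 < num := lt_le_trans d0 dnum.
have -> : theta_factor (b i) t = (1 + 2 * b i * t / num)^-1.
  rewrite /theta_factor -/num.
  have -> : 1 + b i ^+ 2 + b i * t = num + 2 * b i * t by rewrite /num; ring.
  have d1 : 0 < num + 2 * b i * t by rewrite addr_gt0 ?mulr_gt0.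
  by field; rewrite !gt_eqF.
rewrite expRN lef_pV2 ?posrE ?expR_gt0//; last first.
  by rewrite addr_gt0 ?divr_gt0 ?mulr_gt0.
apply: le_trans (expR_ge1Dx _); rewrite lerD2l.
have -> : 2 * t / d * s ^+ i = (2 * t) * (s ^+ i / d) by ring.
have -> : 2 * b i * t / num = (2 * t) * (b i / num) by ring.
rewrite ler_wpM2l ?mulr_ge0 ?(ltW t0)// ler_pM ?(ltW (b0 i)) ?invr_ge0 ?(ltW num0)//.
by rewrite lef_pV2 ?posrE.
Qed.

(** Strictness survives the limit because it is carried by the first factor,
    while the limit is positive. *)
Lemma theta_quot_decr_strict z w : s < z -> z < s^-1 -> s <= w -> w <= s^-1 ->
  z + z^-1 < w + w^-1 -> theta_quot s w < theta_quot s z.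
Proof.
move=> sz zs sw ws tzw.
have z0 := lt_trans s0 sz; have w0 := lt_le_trans s0 sw.
have tz : 0 <= z + z^-1 by have := t_ge2 z0; lra.
have f_lt := theta_factor_decr_strict (b0 0) tz tzw.
have fw0 := factor_ge0 0 sw ws.
have fz0 := le_lt_trans fw0 f_lt.
have Hz0 := theta_quot_gt0 sz zs.
suff : theta_factor (b 0) (z + z^-1) * theta_quot s w <=
    theta_factor (b 0) (w + w^-1) * theta_quot s z.
  by move=> h; rewrite -(ltr_pM2l fz0); apply: le_lt_trans h _; rewrite ltr_pM2r.
have shifted c x : 0 < x ->
    c * \prod_(i < N.+1) theta_factor (b i) (x + x^-1) @[N --> \oo] -->
    c * theta_quot s x.
  move=> x0; apply: cvgM; first exact: cvg_cst.
  have := theta_quot_cvg s0 s1 x0; rewrite -cvg_shiftS; exact.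
have hw' := shifted (theta_factor (b 0) (z + z^-1)) w w0.
have hz' := shifted (theta_factor (b 0) (w + w^-1)) z z0.
rewrite -(cvg_lim _ hz')// -(cvg_lim _ hw')//; apply: ler_lim.
- by apply/cvg_ex; eexists; exact: hw'.
- by apply/cvg_ex; eexists; exact: hz'.
apply: nearW => N /=; rewrite !big_ord_recl /= mulrCA ler_wpM2l//.
rewrite ler_wpM2l ?(ltW fz0)//.
apply: ler_prod => i _; rewrite factor_ge0//=.
exact: theta_factor_decr (ltW (b0 _)) tz (ltW tzw).
Qed.

End ThetaQuotientBounds.

(** * The range of the theta quotient and its multiplication by shifts *)

Section ThetaQuotientRange.
Variables (R : realType) (s : R).
Hypotheses (s0 : 0 < s) (s1 : s < 1).

Let s20 : 0 < s ^+ 2. Proof. by rewrite exprn_gt0. Qed.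

Let t_incr (z w : R) : 1 <= z -> z < w -> z + z^-1 < w + w^-1.
Proof.
move=> z1 zw; have z0 : 0 < z by apply: lt_le_trans z1.
have w0 : 0 < w by apply: lt_trans zw.
rewrite -subr_gt0 (_ : _ - _ = (w - z) * (z * w - 1) / (z * w)).
  rewrite divr_gt0 ?mulr_gt0 ?subr_gt0//.
  by apply: (lt_le_trans (le_lt_trans z1 zw)); rewrite ler_peMl// ltW.
by field; rewrite !gt_eqF.
Qed.

Lemma theta_quot_reflect z : 0 < z ->
  theta_quot s (s ^+ 2 * z)^-1 = - theta_quot s z.
Proof. by move=> z0; rewrite theta_quotV ?mulr_gt0// theta_quot_shift. Qed.

(** The interval is folded at 1/s: on its second half the quotient is minus its
    value at the reflected point. *)
Lemma theta_quot_anti z w : 1 <= z -> z < w -> w <= (s ^+ 2)^-1 ->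
  theta_quot s w < theta_quot s z.
Proof.
have low x y : 1 <= x -> x < y -> y <= s^-1 -> theta_quot s y < theta_quot s x.
  move=> x1 xy ys; apply: theta_quot_decr_strict => //.
  - exact: lt_le_trans x1.
  - exact: lt_le_trans ys.
  - by apply: le_trans (ltW xy); apply: le_trans x1; rewrite ltW.
  - exact: t_incr.
have high x y : s^-1 <= x -> x < y -> y <= (s ^+ 2)^-1 ->
    theta_quot s y < theta_quot s x.
  move=> sx xy ys; have x0 : 0 < x by apply: lt_le_trans sx; rewrite invr_gt0.
  have y0 : 0 < y by apply: lt_trans xy.
  rewrite -ltrN2 -!theta_quot_reflect//; apply: low.
  - by rewrite invf_ge1 ?mulr_gt0// mulrC -ler_pdivlMr// div1r.
  - by rewrite ltf_pV2 ?posrE ?mulr_gt0// ltr_pM2l.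
  - rewrite lef_pV2 ?posrE ?mulr_gt0//.
    by rewrite expr2 -mulrA ler_peMr ?(ltW s0)// mulrC -ler_pdivrMr// div1r.
move=> z1 zw ws; have [w_le|w_gt] := leP w s^-1; first exact: low.
have [z_ge|z_lt] := leP s^-1 z; first exact: high.
by apply: (@lt_trans _ _ (theta_quot s s^-1)); [apply: high|apply: low].
Qed.

(** Intermediate value theorem between z = 1 and z = s^(-2), where the quotient
    takes opposite values. The variable is written 1 + |u| so that the Lipschitz
    bound, which needs z >= 1, holds on the whole line. *)
Lemma theta_quot_surj v : `|v| <= theta_quot s 1 ->
  exists z, [/\ 1 <= z, z <= (s ^+ 2)^-1 & theta_quot s z = v].
Proof.
rewrite ler_norml => /andP[v1 v2].
pose g (u : R) := theta_quot s (1 + `|u|).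
pose C := 2 / (1 - s).
have C0 : 0 < C by rewrite divr_gt0 ?subr_gt0.
have g_lip u w : `|g u - g w| <= C * `|u - w|.
  have pos (x : R) : 1 <= 1 + `|x| by rewrite lerDl.
  have pos0 (x : R) : 0 < 1 + `|x| := lt_le_trans ltr01 (pos x).
  apply: le_trans (theta_quot_lipschitz s0 s1 (pos0 u) (pos0 w)) _.
  rewrite ler_wpM2l ?(ltW C0)//.
  set x := 1 + `|u|; set y := 1 + `|w|.
  have -> : x + x^-1 - (y + y^-1) = (x - y) * (1 - (x * y)^-1).
    by field; rewrite !gt_eqF ?pos0.
  rewrite normrM; apply: (@le_trans _ _ (`|x - y| * 1)).
    rewrite ler_wpM2l//.
    have xy1 : 1 <= x * y by rewrite mulr_ege1// pos.
    have xy0 : 0 < x * y by apply: lt_le_trans xy1.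
    have i1 : (x * y)^-1 <= 1 by rewrite invf_le1.
    have i0 : 0 <= (x * y)^-1 by rewrite invr_ge0 ltW.
    rewrite ger0_norm; lra.
  rewrite mulr1 /x /y opprD addrACA subrr add0r; exact: ler_dist_dist.
have g_cont : continuous g.
  move=> x; apply/cvgrPdist_le => e e0; near=> y.
  apply: le_trans (g_lip _ _) _; rewrite mulrC -ler_pdivlMr//.
  near: y; apply: cvgr_dist_le => //; exact: divr_gt0.
have s2V1 : 1 <= (s ^+ 2)^-1 by rewrite invf_ge1// exprn_ile1 ?ltW.
have le0 : 0 <= (s ^+ 2)^-1 - 1 by rewrite subr_ge0.
have g0E : g 0 = theta_quot s 1 by rewrite /g normr0 addr0.
have g1E : g ((s ^+ 2)^-1 - 1) = - theta_quot s 1.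
  by rewrite /g ger0_norm// addrC subrK -theta_quot_reflect// mulr1.
have := IVT le0 (continuous_subspaceT g_cont) (v := v).
rewrite g0E g1E; case.
  by rewrite ge_min le_max v1 v2 orbT.
move=> c; rewrite in_itv/= => /andP[c0 c1] <-.
exists (1 + `|c|); split=> //; first by rewrite lerDl.
by rewrite ger0_norm//; lra.
Unshelve. all: by end_near. Qed.

End ThetaQuotientRange.

Lemma big_ord_mul (R : realType) (m N : nat) (f : nat -> R) :
  \prod_(i < N * m) f i = \prod_(n < N) \prod_(j < m) f (n * m + j)%N.
Proof.
elim: N => [|N IH]; first by rewrite mul0n !big_ord0.
by rewrite mulSnr big_split_ord/= big_ord_recr/= IH.
Qed.

Section ThetaMultiplication.
Variables (R : realType) (r : R).
Hypotheses (r0 : 0 < r) (r1 : r < 1).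

Let expr_lt1 m : (0 < m)%N -> r ^+ m < 1.
Proof. by move=> m0; rewrite exprn_ilt1 ?(ltW r0)// -lt0n. Qed.

(** The exponents m (2n + 1) + 2j + 1 - m with 0 <= j < m enumerate the odd
    numbers once; for the factors in 1/z the order of the j is reversed. *)
Lemma theta_quot_mult m z : (0 < m)%N -> 0 < z ->
  \prod_(j < m) theta_quot (r ^+ m) (z * (r ^+ (2 * j).+1 / r ^+ m)) =
  theta_quot r z.
Proof.
move=> m0 z0; have rn0 : r != 0 by rewrite gt_eqF.
have pos j : 0 < z * (r ^+ (2 * j).+1 / r ^+ m).
  by rewrite mulr_gt0// divr_gt0// exprn_gt0.
pose L (x : R) := (1 - x) / (1 + x).
have facE b x : 0 < b -> 0 < x -> theta_factor b (x + x^-1) = L (b * x) * L (b / x).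
  move=> b0 x0; rewrite /theta_factor /L.
  have h1 : 0 < 1 + b * x by rewrite addr_gt0 ?mulr_gt0.
  have h2 : 0 < 1 + b / x by rewrite addr_gt0 ?divr_gt0.
  have h3 : 0 < 1 + b ^+ 2 + b * (x + x^-1).
    by rewrite !addr_gt0 ?mulr_gt0 ?exprn_gt0 ?addr_gt0 ?invr_gt0.
  have e1 : 1 + b ^+ 2 - b * (x + x^-1) = (1 - b * x) * (1 - b / x).
    by field; rewrite gt_eqF.
  have e2 : 1 + b ^+ 2 + b * (x + x^-1) = (1 + b * x) * (1 + b / x).
    by field; rewrite gt_eqF.
  by rewrite e1 e2 invfM mulrACA.
pose F N := \prod_(i < N) theta_factor (r ^+ (2 * i).+1) (z + z^-1).
have FE N : F (N * m)%N = \prod_(j < m) \prod_(n < N)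
    theta_factor ((r ^+ m) ^+ (2 * n).+1)
      (z * (r ^+ (2 * j).+1 / r ^+ m) + (z * (r ^+ (2 * j).+1 / r ^+ m))^-1).
  rewrite /F (@big_ord_mul _ m N (fun i => theta_factor (r ^+ (2 * i).+1) (z + z^-1))).
  rewrite [RHS]exchange_big/=; apply: eq_bigr => n _.
  under eq_bigr do rewrite facE ?exprn_gt0//.
  under [RHS]eq_bigr do rewrite facE ?exprn_gt0//.
  rewrite big_split [RHS]big_split/=; congr (_ * _).
    apply: eq_bigr => j _; congr L; rewrite mulrCA [r ^+ _ * z]mulrC; congr (_ * _).
    rewrite -exprM mulrA -exprD; apply: (canRL (mulfK _)); first by rewrite expf_neq0.
    by rewrite -exprD; congr (_ ^+ _); lia.
  rewrite (reindex_inj rev_ord_inj)/=; apply: eq_bigr => j _; congr L.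
  rewrite invfM mulrCA [_ / z]mulrC; congr (_ * _).
  rewrite invfM invrK -exprM mulrCA -exprD mulrC.
  apply: (canRL (mulfK _)); first by rewrite expf_neq0.
  by rewrite -exprD; congr (_ ^+ _); have := ltn_ord j; lia.
have h1 : F (N * m)%N @[N --> \oo] --> theta_quot r z.
  apply: (cvg_comp (fun N => N * m)%N F _ (theta_quot_cvg r0 r1 z0)).
  apply/cvgnyPge => A; near=> N; rewrite (leq_trans _ (leq_pmulr N m0))//.
  by near: N; exact: nbhs_infty_ge.
rewrite -(cvg_lim _ h1)//; apply/esym/cvg_lim => //.
under eq_fun do rewrite FE.
apply: cvg_big => [|j _]; first exact: mul_continuous.
by apply: theta_quot_cvg; rewrite ?exprn_gt0 ?expr_lt1.
Unshelve. all: by end_near. Qed.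

End ThetaMultiplication.

(** * The rational function behind the theta quotient, and values at 1 *)

(** Apply the product of shifts with m = 2k. The shifts come in inverse pairs, so
    the square of the product is a product of terms to which the addition
    theorem applies; the 2k nodes coincide in pairs by the symmetries of the
    theta ratio, which leaves the square of a product of k terms. *)
Lemma theta_quot_rational (R : realType) (r z : R) (k : nat) :
  0 < r -> r < 1 -> (0 < k)%N -> 0 < z ->
  theta_quot r z ^+ 2 =
  (\prod_(j < k) ((theta_ratio (r ^+ k) (r ^+ (2 * j).+1) - theta_ratio (r ^+ k) z) /
                  (theta_ratio (r ^+ k) (r ^+ (2 * j).+1) + theta_ratio (r ^+ k) z))) ^+ 2.
Proof.
move=> r0 r1 k0 z0.
have q0 : 0 < r ^+ k by rewrite exprn_gt0.
have q1 : r ^+ k < 1 by rewrite exprn_ilt1 ?(ltW r0)// -lt0n.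
have rn0 : r != 0 by rewrite gt_eqF.
(* centred shifts: al (2k - 1 - j) is the inverse of al j *)
pose al j := r ^+ (2 * j).+1 / r ^+ (k + k).
have al0 j : 0 < al j by rewrite divr_gt0 ?exprn_gt0.
have al_rev j : (j < k + k)%N -> al (k + k - j.+1)%N = (al j)^-1.
  move=> jk; apply/eqP; rewrite /al invf_div eqr_div ?expf_neq0//; apply/eqP.
  by rewrite -!exprD; congr (_ ^+ _); lia.
pose X := theta_ratio (r ^+ k).
have X0 x : 0 < x -> 0 < X x by move=> x0; exact: theta_ratio_gt0.
have Xal j : X (al j) = (X (r ^+ (2 * j).+1))^-1.
  rewrite -[LHS]invrK /X -theta_ratio_shift//; congr (theta_ratio _ _)^-1.
  by rewrite /al -exprM mulnC mul2n -addnn mulrC mulfVK// expf_neq0.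
have Xrev j : (j < k)%N -> X (r ^+ (2 * (k + (k - j.+1))).+1) = X (r ^+ (2 * j).+1).
  move=> jk; rewrite -[RHS]theta_ratioV ?exprn_gt0// -[RHS]invrK.
  have w0 : 0 < (r ^+ (2 * j).+1)^-1 by rewrite invr_gt0 exprn_gt0.
  rewrite -theta_ratio_shift// -theta_ratio_shift ?mulr_gt0 ?exprn_gt0//.
  congr (theta_ratio _ _); rewrite -exprM mulrA; apply: (canRL (mulfK _)).
    by rewrite expf_neq0.
  by rewrite -!exprD; congr (_ ^+ _); lia.
have kk0 : (0 < k + k)%N by rewrite addn_gt0 k0.
have h1 := theta_quot_mult r0 r1 kk0 z0.
have h2 : \prod_(j < k + k) theta_quot (r ^+ (k + k)) (z / al j) = theta_quot r z.
  rewrite -h1 [RHS](reindex_inj rev_ord_inj)/=; apply: eq_bigr => j _.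
  by rewrite -/(al _) al_rev.
rewrite expr2 -{1}h1 -h2 -big_split/=.
have qq : (r ^+ k) ^+ 2 = r ^+ (k + k) by rewrite -exprM mulnC mul2n addnn.
under eq_bigr => j _.
  have := theta_quot_add q0 q1 z0 (al0 j); rewrite qq => ->.
  rewrite -/(X z) -/(X (al j)) Xal.
  over.
rewrite big_split_ord/= expr2.
have fracE j : (1 - X z * (X (r ^+ (2 * j).+1))^-1) / (1 + X z * (X (r ^+ (2 * j).+1))^-1)
    = (X (r ^+ (2 * j).+1) - X z) / (X (r ^+ (2 * j).+1) + X z).
  have := X0 _ z0; have := X0 _ (exprn_gt0 (2 * j).+1 r0).
  move: (X _) (X _) => x y x0 y0; field.
  by rewrite !gt_eqF ?addr_gt0.
congr (_ * _); first by apply: eq_bigr => j _; rewrite fracE.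
rewrite (reindex_inj rev_ord_inj)/=; apply: eq_bigr => j _.
by rewrite fracE Xrev.
Qed.

Lemma esum_int_parity (R : realType) (F : int -> \bar R) :
  (forall n, 0 <= F n)%E ->
  (\esum_(n in [set: int]) F n =
   \esum_(a in [set: int]) F (a + a)%R + \esum_(a in [set: int]) F (a + a + 1)%R)%E.
Proof.
move=> F0; pose B := [set n : int | exists a : int, n = a + a].
rewrite (esumID B); last by move=> n _; exact: F0.
congr (_ + _)%E.
  apply: (reindex_esum _ _ (fun a : int => a + a)); split.
  - by move=> a _; split=> //; exists a.
  - by move=> a c _ _ /= h; lia.
  - by move=> n [_ [a /= ->]]; exists a.
apply: (reindex_esum _ _ (fun a : int => a + a + 1)); split.
- by move=> a _; split=> //= -[c]; lia.
- by move=> a c _ _ /= h; lia.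
- move=> n [_ /= h]; exists (n %/ 2)%Z => //=.
  have {}h : n <> (n %/ 2)%Z + (n %/ 2)%Z by move=> h'; apply: h; exists (n %/ 2)%Z.
  by lia.
Qed.

Section ThetaNullwerte.
Variables (R : realType) (s : R).
Hypotheses (s0 : 0 < s) (s1 : s < 1).

Let s20 : 0 < s ^+ 2. Proof. by rewrite exprn_gt0. Qed.
Let s21 : s ^+ 2 < 1. Proof. by rewrite exprn_ilt1 // ltW. Qed.
Let s40 : 0 < s ^+ 4. Proof. by rewrite exprn_gt0. Qed.
Let s41 : s ^+ 4 < 1. Proof. by rewrite exprn_ilt1 // ltW. Qed.

(** The addition theorem at z = w = 1 is the Landen transformation of the modulus
    X^2. *)
Lemma theta_ratio1_landen :
  theta_ratio s 1 ^+ 2 = 2 * theta_ratio (s ^+ 2) 1 / (1 + theta_ratio (s ^+ 2) 1 ^+ 2).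
Proof.
rewrite [LHS]expr2 theta_ratio_add// !(mulr1, divr1) expr2; congr (_ / _); ring.
Qed.

Lemma theta_quot1_gt0 : 0 < theta_quot s 1.
Proof. by apply: theta_quot_gt0 => //; rewrite invf_gt1. Qed.

Lemma theta_ratio1_lt1 : theta_ratio s 1 < 1.
Proof.
have := theta_quot1_gt0; rewrite /theta_quot pmulr_lgt0 ?subr_gt0//.
by rewrite invr_gt0 addr_gt0 ?theta_ratio_gt0.
Qed.

Lemma theta_quot1_lt1 : theta_quot s 1 < 1.
Proof.
have x0 := theta_ratio_gt0 s0 s1 ltr01.
by rewrite /theta_quot ltr_pdivrMr ?addr_gt0//; lra.
Qed.

(** H(1)^2 for nome s^4 is the modulus complementary to X(1)^2 for nome s: both
    are rational in X(1) for nome s^2. *)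
Lemma theta_nullwerte_pythagoras :
  (theta_ratio s 1 ^+ 2) ^+ 2 + (theta_quot (s ^+ 4) 1 ^+ 2) ^+ 2 = 1.
Proof.
rewrite theta_ratio1_landen.
have -> : s ^+ 4 = (s ^+ 2) ^+ 2 by rewrite -exprM.
have := theta_quot_add s20 s21 ltr01 ltr01.
rewrite divr1 mulr1 -expr2 => ->.
have := theta_ratio_gt0 s20 s21 ltr01; move: (theta_ratio _ _) => x x0.
field.
by rewrite gt_eqF// addr_gt0 ?mulr_gt0.
Qed.

(** Keep only the first factor of the product for H(1). *)
Lemma theta_ratio1_ge : s <= theta_ratio s 1.
Proof.
have h : theta_quot s 1 <= theta_factor s 2.
  have c := theta_quot_cvg s0 s1 ltr01; rewrite -cvg_shiftS in c.
  rewrite -(cvg_lim _ c)//; apply: limr_le; first by apply/cvg_ex; eexists; exact: c.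
  apply: nearW => N /=; rewrite big_ord_recl/= invr1.
  have s2 : 0 <= theta_factor s (1 + 1).
    have := @theta_factor_ge0 R s 1 s0; rewrite invr1; apply; first exact: ltW.
    by rewrite invf_ge1 ?ltW.
  rewrite -[leRHS]mulr1 ler_wpM2l// ?expr1//.
  apply: le_trans (ler_norm _) _; rewrite normr_prod; apply: prodr_ile1 => i _.
  by rewrite normr_ge0 theta_factor_le1 ?exprn_ge0 ?(ltW s0)// addr_ge0.
have H0 := theta_quot1_gt0.
rewrite theta_ratioE// ler_pdivlMr ?addr_gt0//.
suff : theta_quot s 1 <= (1 - s) / (1 + s).
  by rewrite ler_pdivlMr ?addr_gt0//; lra.
apply: le_trans h _; rewrite /theta_factor.
have -> : (1 + s ^+ 2 - s * 2) / (1 + s ^+ 2 + s * 2) =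
    ((1 - s) / (1 + s)) * ((1 - s) / (1 + s)).
  have s1n : 1 + s != 0 by rewrite gt_eqF ?addr_gt0.
  have -> : 1 + s ^+ 2 + s * 2 = (1 + s) * (1 + s) by ring.
  by field.
rewrite ler_piMr ?divr_ge0 ?subr_ge0 ?(ltW s1) ?addr_ge0 ?(ltW s0)//.
by rewrite ler_pdivrMr ?addr_gt0//; have := s0; lra.
Qed.

(** 1 - H(1) is at most the sum of the 1 - f over the factors f. *)
Lemma theta_ratio1_le : s <= 2^-1 -> theta_ratio s 1 <= 8 * s.
Proof.
move=> s2; have H0 := theta_quot1_gt0.
have : 1 - theta_quot s 1 <= 8 * s.
  have c := theta_quot_cvg s0 s1 ltr01.
  rewrite lerBlDl -lerBlDr -(cvg_lim _ c)//; apply: limr_ge.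
    by apply/cvg_ex; eexists; exact: c.
  apply: nearW => N; rewrite invr1 lerBlDr -lerBlDl.
  apply: (@le_trans _ _ (\sum_(i < N) `|1 - theta_factor (s ^+ (2 * i).+1) (1 + 1)|)).
    apply: le_trans (ler_norm _) _.
    have := @prod_lipschitz R N (fun=> 1) (fun i => theta_factor (s ^+ (2 * i).+1) (1 + 1)).
    rewrite [X in `|X - _|]big1//; apply; first by move=> i; rewrite normr1.
    by move=> i; rewrite theta_factor_le1 ?exprn_ge0 ?(ltW s0)// addr_ge0.
  apply: (@le_trans _ _ (\sum_(i < N) (4 * s) * s ^+ i)).
    apply: ler_sum => i _; set b := s ^+ _.
    have b0 : 0 < b by rewrite exprn_gt0.
    have bs : b <= s * s ^+ i by rewrite -exprS /b ler_wiXn2l ?(ltW s0) ?(ltW s1)//; lia.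
    have -> : 1 - theta_factor b (1 + 1) = 4 * b / (1 + b) ^+ 2.
      rewrite /theta_factor; field.
      rewrite (_ : 1 + b ^+ 2 + b * 2 = (1 + b) ^+ 2); last by ring.
      by rewrite expf_neq0 gt_eqF ?addr_gt0.
    rewrite ger0_norm ?divr_ge0 ?exprn_ge0 ?mulr_ge0 ?addr_ge0 ?(ltW b0)//.
    apply: (@le_trans _ _ (4 * b)); last by rewrite -mulrA ler_wpM2l.
    rewrite ler_piMr ?mulr_ge0 ?(ltW b0)// invf_le1 ?exprn_gt0 ?addr_gt0//.
    by rewrite exprn_ege1// lerDl ltW.
  rewrite -mulr_sumr; apply: (@le_trans _ _ ((4 * s) * (1 - s)^-1)).
    by rewrite ler_wpM2l ?mulr_ge0 ?(ltW s0)// geometric_sum_le ?(ltW s0).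
  rewrite ler_pdivrMr ?subr_gt0//.
  rewrite -subr_ge0 (_ : _ - _ = 4 * s * (1 - 2 * s)); last by ring.
  by rewrite !mulr_ge0 ?(ltW s0)//; lra.
apply: le_trans; rewrite theta_ratioE// ler_pdivrMr ?addr_gt0//.
by rewrite ler_peMr ?subr_ge0 ?(ltW theta_quot1_lt1)// lerDl ltW.
Qed.

(** Even integers 2a have square 4 a^2, and odd ones 2a + 1 have square
    4 a^2 + 4 a + 1: at z = 1 both parts are full theta series of nome s^4. *)
Lemma theta_ratio1E : let Q := s ^+ 4 in
  theta_ratio s 1 = s * (theta_part 0 Q Q + theta_part 1 Q Q) /
    (theta_part 0 Q 1 + theta_part 1 Q 1).
Proof.
move=> Q; rewrite /theta_ratio.
have sn0 : s != 0 by rewrite gt_eqF.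
have tt0 q z n : 0 < q -> 0 < z -> (0 <= (theta_term q z n)%:E :> \bar R)%E.
  by move=> q0 z0; rewrite lee_fin ltW ?theta_term_gt0.
have QE n : Q ^ n = s ^ (4 * n).
  by rewrite /Q exprnP exprz_exp.
have -> : theta_part 0 s 1 = theta_part 0 Q 1 + theta_part 1 Q 1.
  apply: EFin_inj; rewrite EFinD -!theta_evenE// -theta_oddE//.
  rewrite -(@esum_int_parity _ (fun n => (theta_term Q 1 n)%:E)).
    apply: eq_esum => a _; rewrite /theta_term !exp1rz !mulr1 QE; congr (s ^ _)%:E.
    by ring.
  by move=> n; exact: tt0.
have -> : theta_part 1 s 1 = s * (theta_part 0 Q Q + theta_part 1 Q Q).
  apply: EFin_inj; rewrite EFinM EFinD -!theta_evenE// -!theta_oddE//.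
  rewrite -(@esum_int_parity _ (fun n => (theta_term Q Q n)%:E)); last by move=> n; exact: tt0.
  rewrite -esumZl//; last by move=> n _; exact: tt0.
  apply: eq_esum => a _; rewrite -EFinM; congr (_%:E).
  rewrite /theta_term exp1rz mulr1 -expfzDr ?expf_neq0// QE.
  have sS (m : int) : s * s ^ m = s ^ (m + 1) by rewrite expfzDr// expr1z mulrC.
  rewrite sS; congr (s ^ _).
  by ring.
by [].
Qed.

(** Triple products for nome Q = s^4 at z = Q and z = 1. At z = Q the product is
    that of (1 + Q^(2i))(1 + Q^(2i + 2)), which telescopes to squares up to the
    boundary factor 2 / (1 + Q^(2N)). *)
Lemma theta_ratio1_prod :
  \prod_(i < N) ((1 + (s ^+ 4) ^+ (2 * i).+2) ^+ 2 / (1 + (s ^+ 4) ^+ (2 * i).+1) ^+ 2)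
    @[N --> \oo] --> theta_ratio s 1 / (2 * s).
Proof.
set Q := s ^+ 4.
have Q0 : 0 < Q := s40.
have Q1 : Q < 1 := s41.
have [ev [od [hev hod hp _]]] := jacobi_triple_product Q0 Q1 Q0.
have [ev1 [od1 [hev1 hod1 hp1 _]]] := jacobi_triple_product Q0 Q1 ltr01.
have C0 N : 0 < \prod_(i < N) jac_ratio (Q ^+ 2) i by exact: jac_prod_gt0.
have Qn0 : Q != 0 by rewrite gt_eqF.
have Qp n : 0 < 1 + Q ^+ n by rewrite addr_gt0// exprn_gt0.
have step N : \prod_(i < N) ((1 + Q ^+ (2 * i).+2) ^+ 2 / (1 + Q ^+ (2 * i).+1) ^+ 2) =
    (ev N + od N) / (ev1 N + od1 N) * ((1 + Q ^+ (2 * N)) / 2).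
  have -> : (ev N + od N) / (ev1 N + od1 N) =
    \prod_(i < N) ((1 + Q ^+ (2 * i)) * (1 + Q ^+ (2 * i).+2) / (1 + Q ^+ (2 * i).+1) ^+ 2).
    rewrite big_split/= prodfV.
    have -> : \prod_(i < N) ((1 + Q ^+ (2 * i)) * (1 + Q ^+ (2 * i).+2)) =
        \prod_(i < N) jac_ratio (Q ^+ 2) i * (ev N + od N).
      rewrite hp; apply: eq_bigr => i _.
      have -> : (4 * i + 2 = 2 * i + (2 * i).+2)%N by lia.
      move: (2 * i)%N => m.
      by rewrite exprD !exprS; field.
    have -> : \prod_(i < N) (1 + Q ^+ (2 * i).+1) ^+ 2 =
        \prod_(i < N) jac_ratio (Q ^+ 2) i * (ev1 N + od1 N).
      rewrite hp1; apply: eq_bigr => i _.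
      have -> : (4 * i + 2 = (2 * i).+1 * 2)%N by lia.
      by rewrite invr1 exprM; ring.
    by rewrite invfM mulrACA mulfV ?mul1r// gt_eqF.
  elim: N => [|N IH].
    by rewrite !big_ord0 muln0 expr0 mul1r divff.
  rewrite !big_ord_recr/= IH mulnS add2n; field.
  by rewrite !gt_eqF.
under eq_fun do rewrite step.
have -> : theta_ratio s 1 / (2 * s) = (theta_part 0 Q Q + theta_part 1 Q Q) /
    (theta_part 0 Q 1 + theta_part 1 Q 1) * ((1 + 0) / 2).
  rewrite theta_ratio1E.
  have := theta_even_gt0 s40 s41 ltr01; have := theta_odd_gt0 s40 s41 ltr01.
  rewrite -/Q; move: (theta_part 0 Q 1) (theta_part 1 Q 1) => x y y0 x0; field.
  by rewrite !gt_eqF ?addr_gt0.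
apply: cvgM.
  apply: cvgM; first exact: cvgD.
  apply: cvgV; last exact: cvgD.
  by rewrite gt_eqF// addr_gt0 ?theta_even_gt0 ?theta_odd_gt0.
apply: cvgM; last exact: cvg_cst.
apply: cvgD; first exact: cvg_cst.
under eq_fun do rewrite exprM.
by apply: cvg_expr; rewrite ger0_norm ?exprn_ilt1 ?(ltW s40)// ltW// exprn_gt0.
Qed.

End ThetaNullwerte.

(** * Improper integrals over the unit interval *)

Section ImproperIntegral.
Variable R : realType.
Local Notation mu := (@lebesgue_measure R).
Implicit Types (f F : R -> R) (x : nat -> R).

Lemma measurable_fun_oo f (a b : R) :
  (forall t, a < t < b -> {for t, continuous f}) ->
  measurable_fun `]a, b[ (EFin \o f).
Proof.
move=> cf; apply/measurable_EFinP.
apply: measurable_realfun.open_continuous_measurable_fun => //.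
by move=> t; rewrite inE/= in_itv/= => /cf.
Qed.

Lemma measurable_fun_co f (a b : R) :
  (forall t, a <= t < b -> {for t, continuous f}) ->
  measurable_fun `[a, b[ (EFin \o f).
Proof.
move=> cf; have [ab|ba] := ltP a b; last first.
  by rewrite set_itv_ge ?bnd_simp -?leNgt//; exact: measurable_fun_set0.
rewrite -(@setU1itv _ _ (BLeft b) a false) ?bnd_simp//; apply/measurable_funU => //; split.
  exact: measurable_fun_set1.
by apply: measurable_fun_oo => t /andP[t0 t1]; apply: cf; rewrite ltW.
Qed.

Lemma cvg_integral_01 f x :
  nondecreasing_seq x -> (forall n, 0 <= x n < 1) -> x n @[n --> \oo] --> (1 : R) ->
  (forall t, 0 <= t < 1 -> {for t, continuous f}) ->
  (forall t, 0 <= t < 1 -> 0 <= f t) ->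
  (\int[mu]_(t in `[0%R, x n]) (f t)%:E)%E @[n --> \oo] -->
  (\int[mu]_(t in `]0%R, 1%R[) (f t)%:E)%E.
Proof.
move=> xnd x01 x1 cf f0.
have -> : (\int[mu]_(t in `]0%R, 1%R[) (f t)%:E =
    \int[mu]_(t in `[0%R, 1%R[) (f t)%:E)%E.
  apply: integral_itv_obnd_cbnd; apply: measurable_fun_oo => t /andP[t0 t1].
  by apply: cf; rewrite t1 ltW.
have -> : `[0%R : R, 1%R[%classic = \bigcup_n `[0%R, x n]%classic.
  apply/seteqP; split=> t /=; rewrite in_itv/=.
    move=> /andP[t0 t1]; have := cvgr_gt 1 x1 _ t1; case=> N _ /(_ N (leqnn N)) /= tN.
    by exists N => //=; rewrite in_itv/= t0 ltW.
  move=> [n _ /=]; rewrite in_itv/= => /andP[-> tn].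
  by have /andP[_] := x01 n; exact: le_lt_trans.
apply: ge0_nondecreasing_set_cvg_integral => //.
- move=> m n mn; apply/subsetPset => t /=; rewrite !in_itv/= => /andP[-> /le_trans].
  by apply; exact: xnd.
- move=> n; apply: (@measurable_funS _ _ _ _ (`[0%R, 1%R[%classic : set R)) => //.
    move=> t /=; rewrite !in_itv/= => /andP[-> tn].
    by have /andP[_] := x01 n; exact: le_lt_trans.
  exact: measurable_fun_co.
- move=> n t /=; rewrite in_itv/= => /andP[t0 tn]; rewrite lee_fin f0// t0.
  by have /andP[_] := x01 n; exact: le_lt_trans.
Qed.

(** Points increasing to 1, used to exhaust [0, 1[ by compact intervals. *)
Definition exh (n : nat) : R := 1 - n.+2%:R^-1.

Lemma exh_nondecreasing : nondecreasing_seq exh.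
Proof.
by move=> m n mn; rewrite lerD2l lerN2 lef_pV2 ?posrE ?ltr0n// ler_nat.
Qed.

Lemma exh_itv n : 0 < exh n < 1.
Proof.
rewrite subr_gt0 invf_lt1 ?ltr0n// ltr1n/= gtrBl invr_gt0 ltr0n//.
Qed.

Lemma exh_cvg : exh n @[n --> \oo] --> (1 : R).
Proof.
suff : exh n @[n --> \oo] --> (1 - 0 : R) by rewrite subr0.
apply: cvgB; first exact: cvg_cst.
have := @cvg_harmonic R; rewrite -cvg_shiftS; exact.
Qed.

(** The integrands of elliptic integrals are unbounded at 1, so the fundamental
    theorem is applied on [0, x] with x tending to 1, and monotone convergence
    gives the integral. *)
Lemma integral_01_FTC f F (L : R) :
  (forall t, 0 <= t < 1 -> {for t, continuous f}) ->
  (forall t, 0 <= t < 1 -> 0 <= f t) ->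
  (forall t : R, 0 <= t < 1 -> is_derive t 1 F (f t)) ->
  F (exh n) @[n --> \oo] --> L ->
  (\int[mu]_(t in `]0%R, 1%R[) (f t)%:E)%E = (L - F 0)%:E.
Proof.
move=> cf f0 dF FL.
have exh0 n : 0 <= exh n < 1 by have /andP[e0 ->] := exh_itv n; rewrite ltW.
have h1 := cvg_integral_01 exh_nondecreasing exh0 exh_cvg cf f0.
have h2 : (F (exh n) - F 0)%:E @[n --> \oo] --> (L - F 0)%:E.
  apply: cvg_EFin; first exact: nearW.
  by apply: cvgB => //; exact: cvg_cst.
suff e n : (\int[mu]_(t in `[0%R, exh n]) (f t)%:E = (F (exh n) - F 0)%:E)%E.
  by move: h1; rewrite (funext e) => h1; rewrite -(cvg_lim _ h1)//; exact: cvg_lim.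
have /andP[e0 e1] := exh_itv n.
have sub t : 0 <= t <= exh n -> 0 <= t < 1.
  by move=> /andP[-> /le_lt_trans]; apply.
have cF t : 0 <= t < 1 -> {for t, continuous F}.
  move=> /dF dFt; apply: differentiable_continuous; apply/derivable1_diffP.
  exact: ex_derive.
rewrite EFinB; apply: continuous_FTC2 => //.
- apply: continuous_in_subspaceT => t; rewrite inE/= in_itv/= => /sub; exact: cf.
- split.
  + move=> t; rewrite in_itv/= => /andP[t0 t1].
    have t01 : 0 <= t < 1 by rewrite ltW//=; exact: lt_trans t1 e1.
    exact: (@ex_derive _ _ _ _ _ _ _ (dF t t01)).
  + by apply: cvg_at_right_filter; apply: cF; rewrite lexx ltr01.
  + by apply: cvg_at_left_filter; apply: cF; rewrite ltW.
- move=> t; rewrite in_itv/= => /andP[t0 t1]; rewrite derive1E.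
  have t01 : 0 <= t < 1 by rewrite ltW//=; exact: lt_trans t1 e1.
  exact: (@derive_val _ _ _ _ _ _ _ (dF t t01)).
Qed.

End ImproperIntegral.

(** * The complete elliptic integral: integrability and bounds *)

Section EllipticIntegrand.
Variable R : realType.
Local Notation mu := (@lebesgue_measure R).
Implicit Types (m t : R).

Definition ell_fun m t : R :=
  (Num.sqrt ((1 - t ^+ 2) * (1 - m ^+ 2 * t ^+ 2)))^-1.

Lemma ell_rad_gt0 m t : 0 <= m < 1 -> 0 <= t < 1 ->
  0 < 1 - t ^+ 2 /\ 0 < 1 - m ^+ 2 * t ^+ 2.
Proof.
move=> /andP[m0 m1] /andP[t0 t1].
have t2 : t ^+ 2 < 1 by rewrite exprn_ilt1.
have m2 : m ^+ 2 < 1 by rewrite exprn_ilt1.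
split; first by rewrite subr_gt0.
rewrite subr_gt0; apply: le_lt_trans t2; rewrite ler_piMl ?exprn_ge0// ltW//.
Qed.

Lemma continuous_sqrt_inv (g : R -> R) t : 0 < g t -> {for t, continuous g} ->
  {for t, continuous (fun x => (Num.sqrt (g x))^-1)}.
Proof.
move=> g0 cg; apply: cvgV; first by rewrite gt_eqF// sqrtr_gt0.
exact: (continuous_comp cg (@sqrt_continuous _ _)).
Qed.

Lemma ell_fun_ge0 m t : 0 <= ell_fun m t.
Proof. by rewrite invr_ge0 sqrtr_ge0. Qed.

Lemma ell_fun_cont m t : 0 <= m < 1 -> 0 <= t < 1 ->
  {for t, continuous (ell_fun m)}.
Proof.
move=> m01 t01; have [h1 h2] := ell_rad_gt0 m01 t01.
apply: (@continuous_sqrt_inv (fun t => (1 - t ^+ 2) * (1 - m ^+ 2 * t ^+ 2))).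
  exact: mulr_gt0.
have c2 : {for t, continuous (fun x : R => x ^+ 2)} by exact: exprn_continuous.
apply: cvgM; apply: cvgB; try exact: cvg_cst; first exact: c2.
by apply: cvgM; [exact: cvg_cst|exact: c2].
Qed.

(** Below pi / 2 - e the sine stays below a constant smaller than 1. *)
Lemma asin_exh_cvg : asin (exh R n) @[n --> \oo] --> (pi / 2 : R).
Proof.
apply/cvgrPdist_le => /= e e0.
have pi0 := pi_gt0 R.
wlog e1 : e e0 / e < pi / 2.
  move=> h; have := h (Num.min e (pi / 4)).
  rewrite lt_min e0 divr_gt0// gt_min => /(_ isT).
  have -> : pi / 4 < pi / 2 :> R by rewrite ltr_pM2l// ltf_pV2 ?posrE// ltr_nat.
  rewrite orbT => /(_ isT); apply: filterS => n /le_trans; apply.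
  by rewrite ge_min lexx.
have s1 : sin (pi / 2 - e) < 1.
  by rewrite -[ltRHS](sin_pihalf R) ltr_sin ?in_itv/=; try (apply/andP; split); lra.
near=> n.
have e01 : exh R n \in `[-1, 1].
  by have /andP[] := exh_itv R n; rewrite in_itv/= => ? ?; apply/andP; split; lra.
have e01' : -1 <= exh R n <= 1 by move: e01; rewrite in_itv.
have a1 := asin_lepi2 e01'; have a2 := asin_geNpi2 e01'.
rewrite ger0_norm ?subr_ge0// lerBlDr -lerBlDl leNgt; apply/negP => h.
have : sin (asin (exh R n)) < sin (pi / 2 - e) by rewrite ltr_sin ?in_itv/=; try (apply/andP; split); lra.
rewrite asinK//; apply/negP; rewrite -leNgt.
near: n; exact: (cvgr_ge 1 (@exh_cvg R) _ s1).
Unshelve. all: by end_near. Qed.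

Lemma integral_asin :
  (\int[mu]_(t in `]0%R, 1%R[) ((Num.sqrt (1 - t ^+ 2))^-1)%:E)%E = (pi / 2)%:E.
Proof.
have rad t : 0 <= t < 1 -> 0 < 1 - t ^+ 2.
  by move=> t01; have [] := @ell_rad_gt0 0 t; rewrite ?lexx ?ltr01.
have cf t : 0 <= t < 1 -> {for t, continuous (fun t => (Num.sqrt (1 - t ^+ 2))^-1)}.
  move=> t01; apply: (@continuous_sqrt_inv (fun t => 1 - t ^+ 2)); first exact: rad.
  apply: cvgB; [exact: cvg_cst|exact: exprn_continuous].
have f0 t : 0 <= t < 1 -> 0 <= (Num.sqrt (1 - t ^+ 2))^-1.
  by move=> _; rewrite invr_ge0 sqrtr_ge0.
have dF (t : R) : 0 <= t < 1 -> is_derive t 1 asin (Num.sqrt (1 - t ^+ 2))^-1.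
  by move=> /andP[t0 t1]; apply: is_derive1_asin; rewrite t1 andbT; lra.
have asin0 : asin (0 : R) = 0.
  rewrite -{1}(@sin0 R) sinK// in_itv/=; have := pi_gt0 R.
  by move=> h; apply/andP; split; lra.
by rewrite (integral_01_FTC cf f0 dF asin_exh_cvg) asin0 subr0.
Qed.

Lemma ell_fun_measurable m : 0 <= m < 1 ->
  measurable_fun (`]0%R, 1%R[%classic : set R) (EFin \o ell_fun m).
Proof.
move=> m01; apply: measurable_fun_oo => t /andP[t0 t1].
by apply: ell_fun_cont => //; rewrite t1 ltW.
Qed.

Lemma asin_measurable :
  measurable_fun (`]0%R, 1%R[%classic : set R) (EFin \o (fun t : R => (Num.sqrt (1 - t ^+ 2))^-1)).
Proof.
apply: measurable_fun_oo => t /andP[t0 t1].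
apply: (@continuous_sqrt_inv (fun t => 1 - t ^+ 2)).
  by rewrite subr_gt0 exprn_ilt1 // ltW.
apply: cvgB; [exact: cvg_cst|exact: exprn_continuous].
Qed.

(** This bound and the next one compare the integrand with that of the arcsine,
    by 1 - m^2 <= 1 - m^2 t^2 <= 1. *)
Lemma ell_int_ge m : 0 <= m < 1 ->
  ((pi / 2)%:E <= \int[mu]_(t in `]0%R, 1%R[) (ell_fun m t)%:E)%E.
Proof.
move=> m01; rewrite -integral_asin; apply: ge0_le_integral.
- by [].
- by move=> t _; rewrite lee_fin invr_ge0 sqrtr_ge0.
- exact: asin_measurable.
- exact: ell_fun_measurable.
- move=> t; rewrite /= in_itv/= => /andP[t0 t1]; rewrite lee_fin.
  have t01 : 0 <= t < 1 by rewrite ltW.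
  have [h1 h2] := ell_rad_gt0 m01 t01.
  rewrite lef_pV2 ?posrE ?sqrtr_gt0 ?mulr_gt0// ler_sqrt// ?mulr_ge0 ?(ltW h1) ?(ltW h2)//.
  by rewrite ler_piMr ?(ltW h1)// gerBl mulr_ge0 ?sqr_ge0.
Qed.

Lemma ell_int_le m : 0 <= m < 1 ->
  (\int[mu]_(t in `]0%R, 1%R[) (ell_fun m t)%:E <=
    (pi / 2 / Num.sqrt (1 - m ^+ 2))%:E)%E.
Proof.
move=> m01; have m2 : 0 < 1 - m ^+ 2.
  by have /andP[m0 m1] := m01; rewrite subr_gt0 exprn_ilt1.
rewrite mulrC EFinM -integral_asin -ge0_integralZl_EFin; last 4 first.
- by [].
- by move=> t _; rewrite lee_fin invr_ge0 sqrtr_ge0.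
- exact: asin_measurable.
- by rewrite invr_ge0 sqrtr_ge0.
apply: ge0_le_integral.
- by [].
- by move=> t _; rewrite lee_fin ell_fun_ge0.
- exact: ell_fun_measurable.
- apply: emeasurable_funM; first exact: measurable_cst.
  exact: asin_measurable.
- move=> t; rewrite /= in_itv/= => /andP[t0 t1]; rewrite -EFinM lee_fin.
  have t01 : 0 <= t < 1 by rewrite ltW.
  have [h1 h2] := ell_rad_gt0 m01 t01.
  rewrite /ell_fun sqrtrM ?(ltW h1)// -invfM mulrC.
  rewrite lef_pV2 ?posrE ?mulr_gt0 ?sqrtr_gt0// ler_wpM2r ?sqrtr_ge0//.
  rewrite ler_sqrt ?(ltW h2)// lerD2l lerN2 ler_piMr ?sqr_ge0//.
  by rewrite exprn_ile1// ltW.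
Qed.

Lemma ellipticKE m : 0 <= m < 1 ->
  (\int[mu]_(t in `]0%R, 1%R[) (ell_fun m t)%:E = (ellipticK m)%:E)%E.
Proof.
move=> m01; rewrite /ellipticK /Rintegral fineK// ge0_fin_numE.
  by apply: le_lt_trans (ell_int_le m01) _; exact: ltry.
by apply: integral_ge0 => t _; rewrite lee_fin ell_fun_ge0.
Qed.

Lemma ellipticK_ge m : 0 <= m < 1 -> pi / 2 <= ellipticK m.
Proof. by move=> m01; rewrite -lee_fin -ellipticKE// ell_int_ge. Qed.

Lemma ellipticK_le m : 0 <= m < 1 -> ellipticK m <= pi / 2 / Num.sqrt (1 - m ^+ 2).
Proof. by move=> m01; rewrite -lee_fin -ellipticKE// ell_int_le. Qed.

Lemma ellipticK_gt0 m : 0 <= m < 1 -> 0 < ellipticK m.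
Proof.
by move=> m01; apply: lt_le_trans (ellipticK_ge m01); rewrite divr_gt0 ?pi_gt0.
Qed.

End EllipticIntegrand.

(** * Logarithmic growth of the elliptic integral, Landen transformation *)

Section EllipticIdentities.
Variable R : realType.
Local Notation mu := (@lebesgue_measure R).
Implicit Types (m t : R).

(** With the extra factor t the integrand has an elementary primitive,
    - ln(m sqrt(1 - t^2) + sqrt(1 - m^2 t^2)) / m. This integral carries the
    logarithmic growth of K as m tends to 1. *)
Lemma integral_ell_fun_id m : 0 < m < 1 ->
  (\int[mu]_(t in `]0%R, 1%R[) (t * ell_fun m t)%:E =
   ((ln (1 + m) - ln (Num.sqrt (1 - m ^+ 2))) / m)%:E)%E.
Proof.
move=> /andP[m0 m1]; have m01 : 0 <= m < 1 by rewrite ltW.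
(* the primitive is - ln (w t) / m *)
pose w t := m * Num.sqrt (1 - t ^+ 2) + Num.sqrt (1 - m ^+ 2 * t ^+ 2).
pose G t := - m^-1 * ln (w t).
have cf t : 0 <= t < 1 -> {for t, continuous (fun t => t * ell_fun m t)}.
  by move=> t01; apply: cvgM; [exact: cvg_id|exact: ell_fun_cont].
have f0 t : 0 <= t < 1 -> 0 <= t * ell_fun m t.
  by move=> /andP[t0 _]; rewrite mulr_ge0// ell_fun_ge0.
have dG (t : R) : 0 <= t < 1 -> is_derive t 1 G (t * ell_fun m t).
  move=> t01; have [u0 v0] := ell_rad_gt0 m01 t01.
  have du : is_derive t 1 (fun x : R => 1 - x ^+ 2) (- (2 * t)).
    by apply: is_derive_eq; rewrite /GRing.scale/=; ring.
  have dv : is_derive t 1 (fun x : R => 1 - m ^+ 2 * x ^+ 2) (- (m ^+ 2 * (2 * t))).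
    by apply: is_derive_eq; rewrite /GRing.scale/=; ring.
  have dsu := @is_derive1_comp _ Num.sqrt (fun x => 1 - x ^+ 2) t _ _ (is_derive1_sqrt u0) du.
  have dsv := @is_derive1_comp _ Num.sqrt (fun x => 1 - m ^+ 2 * x ^+ 2) t _ _ (is_derive1_sqrt v0) dv.
  have su0 : 0 < Num.sqrt (1 - t ^+ 2) by rewrite sqrtr_gt0.
  have sv0 : 0 < Num.sqrt (1 - m ^+ 2 * t ^+ 2) by rewrite sqrtr_gt0.
  have w0 : 0 < w t by rewrite addr_gt0 ?mulr_gt0.
  have dw : is_derive t 1 w (m * ((2 * Num.sqrt (1 - t ^+ 2))^-1 * (- (2 * t))) +
      (2 * Num.sqrt (1 - m ^+ 2 * t ^+ 2))^-1 * (- (m ^+ 2 * (2 * t)))).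
    apply: is_deriveD; exact: (is_deriveZ m dsu).
  have dl := @is_derive1_comp _ (@ln R) w t _ _ (is_derive1_ln w0) dw.
  apply: (is_derive_eq (is_deriveZ (- m^-1) dl)).
  rewrite /ell_fun sqrtrM ?(ltW u0)// /w /GRing.scale/=.
  move: (Num.sqrt (1 - t ^+ 2)) (Num.sqrt (1 - m ^+ 2 * t ^+ 2)) su0 sv0 => x y x0 y0.
  by field; rewrite !gt_eqF// ?addr_gt0 ?mulr_gt0.
have G1 : G (exh R n) @[n --> \oo] --> - m^-1 * ln (w 1).
  have w1 : 0 < w 1.
    rewrite /w !expr1n subrr sqrtr0 mulr0 add0r mulr1 sqrtr_gt0.
    by rewrite subr_gt0 exprn_ilt1 // ltW.
  have cG : {for 1, continuous G}.
    have c2 (x : R) : {for x, continuous (fun x : R => x ^+ 2)} by exact: exprn_continuous.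
    have csu : {for 1, continuous (fun t : R => Num.sqrt (1 - t ^+ 2))}.
      have h : {for 1, continuous (fun t : R => 1 - t ^+ 2)}.
        by apply: cvgB; [exact: cvg_cst|exact: c2].
      exact: (continuous_comp h (@sqrt_continuous _ _)).
    have csv : {for 1, continuous (fun t : R => Num.sqrt (1 - m ^+ 2 * t ^+ 2))}.
      have h : {for 1, continuous (fun t : R => 1 - m ^+ 2 * t ^+ 2)}.
        apply: cvgB; first exact: cvg_cst.
        by apply: cvgM; [exact: cvg_cst|exact: c2].
      exact: (continuous_comp h (@sqrt_continuous _ _)).
    have cw : {for 1, continuous w}.
      apply: cvgD; last exact: csv.
      by apply: cvgM; [exact: cvg_cst|exact: csu].
    apply: cvgM; first exact: cvg_cst.
    exact: (continuous_comp cw (continuous_ln w1)).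
  exact: (cvg_comp _ _ (@exh_cvg R) cG).
rewrite (integral_01_FTC cf f0 dG G1) /G /w expr0n /= subr0 mulr0 subr0 sqrtr1.
rewrite !expr1n subrr sqrtr0 mulr0 add0r !mulr1; congr (_%:E).
rewrite [m + 1]addrC; ring.
Qed.

Lemma ellipticK_ln_ge m : 0 < m < 1 ->
  (ln (1 + m) - ln (Num.sqrt (1 - m ^+ 2))) / m <= ellipticK m.
Proof.
move=> m01'; have m01 : 0 <= m < 1 by have /andP[? ->] := m01'; rewrite ltW.
rewrite -lee_fin -ellipticKE// -integral_ell_fun_id//; apply: ge0_le_integral.
- by [].
- move=> t /=; rewrite in_itv/= => /andP[t0 _].
  by rewrite lee_fin mulr_ge0 ?ell_fun_ge0 ?ltW.
- apply: measurable_fun_oo => t /andP[t0 t1]; apply: cvgM; first exact: cvg_id.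
  by apply: ell_fun_cont => //; rewrite t1 ltW.
- exact: ell_fun_measurable.
- move=> t /=; rewrite in_itv/= => /andP[t0 t1].
  by rewrite lee_fin ler_piMl ?ell_fun_ge0// ltW.
Qed.

(** Without the factor t one loses at most the integral of
    (1 - t) / (1 - t^2) <= 1. *)
Lemma ellipticK_ln_le m : 0 < m < 1 ->
  ellipticK m <= (ln (1 + m) - ln (Num.sqrt (1 - m ^+ 2))) / m + 1.
Proof.
move=> m01'; have m01 : 0 <= m < 1 by have /andP[? ->] := m01'; rewrite ltW.
have mid : measurable_fun (`]0%R, 1%R[%classic : set R) (EFin \o (fun t => t * ell_fun m t)).
  apply: measurable_fun_oo => t /andP[t0 t1]; apply: cvgM; first exact: cvg_id.
  by apply: ell_fun_cont => //; rewrite t1 ltW.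
have id0 t : (`]0%R, 1%R[%classic : set R) t -> (0 <= (t * ell_fun m t)%:E)%E.
  rewrite /= in_itv/= => /andP[t0 _].
  by rewrite lee_fin mulr_ge0 ?ell_fun_ge0 ?ltW.
rewrite -lee_fin -ellipticKE// EFinD -integral_ell_fun_id//.
have -> : (1%:E = \int[mu]_(t in `]0%R, 1%R[) (cst 1%:E) t)%E.
  by rewrite integral_cst//= lebesgue_measure_itv/= lte_fin ltr01 oppr0 adde0 mule1.
rewrite -ge0_integralD; [|by []|exact: id0|exact: mid|by move=> t _; exact: lee01|exact: measurable_cst].
apply: ge0_le_integral.
- by [].
- by move=> t _; rewrite lee_fin ell_fun_ge0.
- exact: ell_fun_measurable.
- by apply: emeasurable_funD => //; exact: measurable_cst.
- move=> t /=; rewrite in_itv/= => /andP[t0 t1].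
  have t01 : 0 <= t < 1 by rewrite ltW.
  have [u0 v0] := ell_rad_gt0 m01 t01.
  rewrite -EFinD lee_fin -lerBlDl -[X in X - _]mul1r -mulrBl.
  have e : ell_fun m t <= (1 - t ^+ 2)^-1.
    rewrite lef_pV2 ?posrE ?sqrtr_gt0 ?mulr_gt0//.
    rewrite -[leLHS]ger0_norm ?(ltW u0)// -sqrtr_sqr ler_sqrt ?mulr_ge0 ?(ltW u0) ?(ltW v0)//.
    rewrite expr2 ler_wpM2l ?(ltW u0)// lerD2l lerN2 ler_piMl ?sqr_ge0//.
    by have /andP[? ?] := m01; rewrite exprn_ile1// ltW.
  apply: (@le_trans _ _ ((1 - t) * (1 - t ^+ 2)^-1)).
    by rewrite ler_wpM2l// subr_ge0 ltW.
  by rewrite ler_pdivrMr// mul1r lerD2l lerN2 expr2 ler_piMr ?(ltW t0) ?(ltW t1).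
Qed.

(** The substitution is t = (1 + m) x / (1 + m x^2), an increasing bijection of
    the unit interval. It is performed on compact subintervals. *)
Lemma ellipticK_landen m : 0 < m < 1 ->
  ellipticK (2 * Num.sqrt m / (1 + m)) = (1 + m) * ellipticK m.
Proof.
move=> /andP[m0 m1]; have m01 : 0 <= m < 1 by rewrite ltW.
set k := 2 * _ / _.
have mp0 : 0 < 1 + m by rewrite addr_gt0.
have sm0 : 0 < Num.sqrt m by rewrite sqrtr_gt0.
have smE : Num.sqrt m ^+ 2 = m by rewrite sqr_sqrtr// ltW.
have k01 : 0 <= k < 1.
  rewrite divr_ge0 ?mulr_ge0 ?(ltW sm0) ?(ltW mp0)//= ltr_pdivrMr// mul1r.
  rewrite -subr_gt0 -{1}smE (_ : _ - _ = (1 - Num.sqrt m) ^+ 2); last by ring.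
  by rewrite exprn_gt0// subr_gt0 -[ltRHS]sqrtr1 ltr_sqrt.
pose tau x := (1 + m) * x / (1 + m * x ^+ 2).
have den x : 0 < 1 + m * x ^+ 2.
  by rewrite ltr_pwDl// mulr_ge0 ?sqr_ge0// ltW.
have denn x : 1 + m * x ^+ 2 != 0 by rewrite gt_eqF.
pose tau' x := (1 + m) * (1 - m * x ^+ 2) / (1 + m * x ^+ 2) ^+ 2.
have dtau (x : R) : is_derive x 1 tau (tau' x).
  have d1 : is_derive x 1 (fun x : R => (1 + m) * x) (1 + m).
    by apply: is_derive_eq; rewrite /GRing.scale/=; ring.
  have d2 : is_derive x 1 (fun x : R => 1 + m * x ^+ 2) (m * (2 * x)).
    by apply: is_derive_eq; rewrite /GRing.scale/=; ring.
  have d3 := @is_deriveV _ (fun x => 1 + m * x ^+ 2) _ _ _ (denn x) d2.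
  apply: (is_derive_eq (is_deriveM d1 d3)).
  rewrite /tau' /GRing.scale/=; field; exact: denn.
have tau'E : tau^`()%classic = tau'.
  by apply/funext => x; rewrite derive1E; exact: (@derive_val _ _ _ _ _ _ _ (dtau x)).
have ctau : continuous tau.
  move=> x; apply: differentiable_continuous; apply/derivable1_diffP.
  exact: (@ex_derive _ _ _ _ _ _ _ (dtau x)).
have ctau' : continuous tau'.
  move=> x; have c2 : {for x, continuous (fun x : R => x ^+ 2)} by exact: exprn_continuous.
  have cm : {for x, continuous (fun x : R => m * x ^+ 2)}.
    by apply: cvgM; [exact: cvg_cst|exact: c2].
  apply: cvgM.
    by apply: cvgM; [exact: cvg_cst|apply: cvgB; [exact: cvg_cst|exact: cm]].
  apply: cvgV; first by rewrite expf_neq0.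
  have cd : {for x, continuous (fun x : R => 1 + m * x ^+ 2)}.
    by apply: cvgD; [exact: cvg_cst|exact: cm].
  exact: (continuous_comp cd (@exprn_continuous _ 2 _)).
have tau_incr x y : 0 <= x -> x < y -> y <= 1 -> tau x < tau y.
  move=> x0 xy y1; rewrite /tau ltr_pdivrMr// mulrAC ltr_pdivlMr//.
  rewrite -subr_gt0 (_ : _ - _ = (1 + m) * ((y - x) * (1 - m * (x * y)))); last by ring.
  rewrite !mulr_gt0 ?subr_gt0//; apply: le_lt_trans m1.
  rewrite ler_piMr ?(ltW m0)// mulr_ile1//; last exact: le_trans (ltW xy) y1.
  exact: le_trans x0 (ltW xy).
have tau0 : tau 0 = 0 by rewrite /tau mulr0 mul0r.
have tau1 : tau 1 = 1 by rewrite /tau expr1n !mulr1 divff// gt_eqF.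
pose y n := tau (exh R n).
have y01 n : 0 <= y n < 1.
  have /andP[e0 e1] := exh_itv R n.
  apply/andP; split; first by rewrite -[leLHS]tau0 ltW// tau_incr// ltW.
  by rewrite -[ltRHS]tau1 tau_incr// ltW.
have ynd : nondecreasing_seq y.
  move=> a b ab; have := @exh_nondecreasing R a b ab.
  rewrite le_eqVlt => /predU1P[e|lt]; first by rewrite /y e.
  have /andP[a0 _] := exh_itv R a; have /andP[_ b1] := exh_itv R b.
  by rewrite ltW// tau_incr// ltW.
have y1 : y n @[n --> \oo] --> (1 : R).
  rewrite -tau1; exact: (cvg_comp _ _ (@exh_cvg R) (ctau 1)).
have ck t : 0 <= t < 1 -> {for t, continuous (ell_fun k)} by exact: ell_fun_cont.
have k0 t : 0 <= t < 1 -> 0 <= ell_fun k t by move=> _; exact: ell_fun_ge0.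
have h1 := cvg_integral_01 ynd y01 y1 ck k0.
have cm t : 0 <= t < 1 -> {for t, continuous (fun t => (1 + m) * ell_fun m t)}.
  by move=> t01; apply: cvgM; [exact: cvg_cst|exact: ell_fun_cont].
have fm0 t : 0 <= t < 1 -> 0 <= (1 + m) * ell_fun m t.
  by move=> _; rewrite mulr_ge0 ?ell_fun_ge0 ?ltW.
have exh0 n : 0 <= exh R n < 1 by have /andP[e0 ->] := exh_itv R n; rewrite ltW.
have h2 := cvg_integral_01 (@exh_nondecreasing R) exh0 (@exh_cvg R) cm fm0.
have step n : (\int[mu]_(t in `[0%R, y n]) (ell_fun k t)%:E =
    \int[mu]_(t in `[0%R, exh R n]) ((1 + m) * ell_fun m t)%:E)%E.
  have /andP[e0 e1] := exh_itv R n.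
  rewrite -{1}tau0 /y integration_by_substitution_increasing//; last 7 first.
  - exact: ltW.
  - move=> a b; rewrite !in_itv/= => /andP[a0 ae] /andP[b0 be] ab.
    by apply: tau_incr => //; apply: le_trans be _; rewrite ltW.
  - by move=> x _; rewrite tau'E; exact: ctau'.
  - rewrite tau'E; apply/cvg_ex; exists (tau' 0); apply: cvg_at_right_filter; exact: ctau'.
  - rewrite tau'E; apply/cvg_ex; exists (tau' (exh R n)); apply: cvg_at_left_filter; exact: ctau'.
  - split; first by move=> x _; exact: (@ex_derive _ _ _ _ _ _ _ (dtau x)).
      by apply: cvg_at_right_filter; exact: ctau.
    by apply: cvg_at_left_filter; exact: ctau.
  - apply: continuous_in_subspaceT => t; rewrite inE/= in_itv/= tau0 => /andP[t0 te].
    apply: ck; rewrite t0/=; apply: le_lt_trans te _.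
    by have /andP[] := y01 n.
  apply: eq_integral => t; rewrite inE/= in_itv/= => /andP[t0 te]; congr (_%:E).
  have t01 : 0 <= t < 1 by rewrite t0/=; apply: le_lt_trans e1.
  rewrite tau'E; transitivity (ell_fun k (tau t) * tau' t) => //.
  rewrite /ell_fun /tau'.
  (* the algebraic identity behind the substitution *)
  have -> : (1 - tau t ^+ 2) * (1 - k ^+ 2 * tau t ^+ 2) =
      ((1 - t ^+ 2) * (1 - m ^+ 2 * t ^+ 2)) *
      ((1 - m * t ^+ 2) / (1 + m * t ^+ 2) ^+ 2) ^+ 2.
    have -> : k ^+ 2 = 4 * m / (1 + m) ^+ 2.
      by rewrite /k expr_div_n exprMn smE; congr (_ * _ / _); ring.
    by rewrite /tau; field; rewrite denn gt_eqF.
  have [u0 v0] := ell_rad_gt0 m01 t01.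
  have mt : 0 < 1 - m * t ^+ 2.
    have /andP[? t1] := t01; rewrite subr_gt0; apply: le_lt_trans m1.
    by rewrite ler_piMr ?(ltW m0)// exprn_ile1// ltW.
  have q0 : 0 < (1 - m * t ^+ 2) / (1 + m * t ^+ 2) ^+ 2.
    by rewrite divr_gt0 ?exprn_gt0.
  rewrite sqrtrM ?mulr_ge0 ?(ltW u0) ?(ltW v0)// sqrtr_sqr ger0_norm ?(ltW q0)//.
  have : 0 < Num.sqrt ((1 - t ^+ 2) * (1 - m ^+ 2 * t ^+ 2)) by rewrite sqrtr_gt0 mulr_gt0.
  move: (Num.sqrt _) => x x0; field.
  by rewrite denn !gt_eqF.
move: h1; rewrite (funext step) => h1.
have : (\int[mu]_(t in `]0%R, 1%R[) (ell_fun k t)%:E =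
    \int[mu]_(t in `]0%R, 1%R[) ((1 + m) * ell_fun m t)%:E)%E.
  by rewrite -(cvg_lim _ h1)// -(cvg_lim _ h2).
under [X in _ = X -> _]eq_integral do rewrite EFinM.
rewrite ge0_integralZl_EFin; last 4 first.
- by [].
- by move=> t _; rewrite lee_fin ell_fun_ge0.
- exact: ell_fun_measurable.
- exact: ltW.
by rewrite !ellipticKE// -EFinM => -[].
Qed.

End EllipticIdentities.

(** * The ratio of periods determines the modulus *)

Section PeriodRatio.
Variable R : realType.
Implicit Types (l m x y : R).

(** pi K(l') / K(l), with l' the complementary modulus: minus the logarithm of the
    nome of l. *)
Definition period_ratio l : R :=
  pi * ellipticK (Num.sqrt (1 - l ^+ 2)) / ellipticK l.

Lemma compl_modulus l : 0 < l < 1 ->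
  [/\ 0 < Num.sqrt (1 - l ^+ 2), Num.sqrt (1 - l ^+ 2) < 1 &
      Num.sqrt (1 - l ^+ 2) ^+ 2 = 1 - l ^+ 2].
Proof.
move=> /andP[l0 l1]; have h : 0 < 1 - l ^+ 2 by rewrite subr_gt0 exprn_ilt1 // ltW.
split; [by rewrite sqrtr_gt0| |by rewrite sqr_sqrtr// ltW].
by rewrite -[ltRHS]sqrtr1 ltr_sqrt// gtrBl exprn_gt0.
Qed.

Lemma compl_modulusK l : 0 < l < 1 ->
  Num.sqrt (1 - Num.sqrt (1 - l ^+ 2) ^+ 2) = l.
Proof.
move=> l01; have [_ _ ->] := compl_modulus l01; rewrite opprB addrC subrK sqrtr_sqr.
by rewrite ger0_norm// ltW//; case/andP: l01.
Qed.

Lemma period_ratio_gt0 l : 0 < l < 1 -> 0 < period_ratio l.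
Proof.
move=> l01; have [h1 h2 _] := compl_modulus l01; have /andP[l0 l1] := l01.
by rewrite divr_gt0 ?mulr_gt0 ?pi_gt0 ?ellipticK_gt0 ?l1 ?h2 ?ltW.
Qed.

Lemma period_ratio_compl l : 0 < l < 1 ->
  period_ratio (Num.sqrt (1 - l ^+ 2)) = pi ^+ 2 / period_ratio l.
Proof.
move=> l01; rewrite /period_ratio compl_modulusK//.
have [h1 h2 _] := compl_modulus l01; have /andP[l0 l1] := l01.
have k1 : ellipticK l != 0 by rewrite gt_eqF// ellipticK_gt0// l1 ltW.
have k2 : ellipticK (Num.sqrt (1 - l ^+ 2)) != 0.
  by rewrite gt_eqF// ellipticK_gt0// h2 ltW.
have p0 : pi != 0 :> R by rewrite gt_eqF ?pi_gt0.
move: (pi : R) p0 => p p0; by field; rewrite k1 k2 p0.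
Qed.

(** Landen's transformation is used for x, and for m = (1 - x) / (1 + x), whose
    transform is the modulus complementary to x. *)
Lemma period_ratio_landen x : 0 < x < 1 ->
  period_ratio x = 2 * period_ratio (2 * Num.sqrt x / (1 + x)).
Proof.
move=> x01; have /andP[x0 x1] := x01.
have xp0 : 0 < 1 + x by rewrite addr_gt0.
have xm0 : 0 < 1 - x by rewrite subr_gt0.
have sxE : Num.sqrt x ^+ 2 = x by rewrite sqr_sqrtr// ltW.
pose m := (1 - x) / (1 + x).
have m01 : 0 < m < 1 by rewrite divr_gt0//= ltr_pdivrMr// mul1r; lra.
have /andP[m0 m1] := m01.
have -> : period_ratio (2 * Num.sqrt x / (1 + x)) =
    pi * ellipticK m / ((1 + x) * ellipticK x).
  rewrite /period_ratio ellipticK_landen//; congr (_ * ellipticK _ / _).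
  rewrite (_ : 1 - _ = m ^+ 2); first by rewrite sqrtr_sqr ger0_norm// ltW.
  rewrite expr_div_n exprMn sxE /m; field.
  by rewrite gt_eqF.
have -> : period_ratio x = pi * ((1 + m) * ellipticK m) / ellipticK x.
  rewrite /period_ratio -ellipticK_landen//; congr (_ * ellipticK _ / _).
  rewrite mulrAC (_ : 2 / (1 + m) = 1 + x); last first.
    by rewrite /m; field; rewrite !gt_eqF// (_ : _ + _ = 2)//; ring.
  rewrite -[X in X * _]ger0_norm ?(ltW xp0)// -sqrtr_sqr -sqrtrM ?sqr_ge0//.
  by congr Num.sqrt; rewrite /m; field; rewrite gt_eqF.
have k1 : ellipticK x != 0 by rewrite gt_eqF// ellipticK_gt0// x1 ltW.
have -> : 1 + m = 2 / (1 + x) by rewrite /m; field; rewrite gt_eqF.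
move: (pi : R) => p; by field; rewrite k1 gt_eqF.
Qed.

(** Together with the next lemma: for small moduli the period ratio is
    - 2 ln l up to a bounded error. *)
Lemma period_ratio_ge l : 0 < l < 1 -> - (2 * ln l) <= period_ratio l.
Proof.
move=> l01; have [m0 m1 m2] := compl_modulus l01; have /andP[l0 l1] := l01.
have := compl_modulusK l01; rewrite /period_ratio.
set m := Num.sqrt (1 - l ^+ 2) in m0 m1 m2 *; move=> mK.
have l01' : 0 <= l < 1 by rewrite ltW.
have m01 : 0 < m < 1 by rewrite m0.
rewrite ler_pdivlMr ?ellipticK_gt0//.
have lnl : 0 <= - ln l by rewrite oppr_ge0 ln_le0// ltW.
have h1 := ellipticK_le l01'; rewrite -/m in h1.
have h2 := ellipticK_ln_ge m01; rewrite mK in h2.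
have pi0 := pi_gt0 R.
have lnm : 0 <= ln (1 + m) by rewrite ln_ge0// lerDl ltW.
apply: (@le_trans _ _ (- (2 * ln l) * (pi / 2 / m))).
  by rewrite ler_wpM2l// oppr_ge0 pmulr_rle0//; lra.
apply: (@le_trans _ _ (pi * ((ln (1 + m) - ln l) / m))); last by rewrite ler_wpM2l// ltW.
rewrite (_ : - (2 * ln l) * _ = pi * ((- ln l) / m)); last first.
  by move: (pi : R) => p; field; rewrite gt_eqF.
by rewrite ler_wpM2l ?(ltW pi0)// ler_wpM2r ?invr_ge0 ?(ltW m0)//; lra.
Qed.

Lemma period_ratio_le l : 0 < l -> l <= 2^-1 ->
  period_ratio l <= - (2 * ln l) + 6.
Proof.
move=> l0 l2; have l1 : l < 1 by lra.
have l01 : 0 < l < 1 by rewrite l0.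
have [m0 m1 m2] := compl_modulus l01.
have := compl_modulusK l01; rewrite /period_ratio.
set m := Num.sqrt (1 - l ^+ 2) in m0 m1 m2 *; move=> mK.
have l01' : 0 <= l < 1 by rewrite ltW.
have m01 : 0 < m < 1 by rewrite m0.
have pi0 := pi_gt0 R.
have h1 := ellipticK_ge l01'.
have h2 := ellipticK_ln_le m01; rewrite mK in h2.
have K0 : 0 < ellipticK m by rewrite ellipticK_gt0// m1 ltW.
apply: (@le_trans _ _ (pi * ellipticK m / (pi / 2))).
  by rewrite ler_wpM2l ?mulr_ge0 ?(ltW pi0) ?(ltW K0)// lef_pV2 ?posrE ?divr_gt0// ellipticK_gt0.
rewrite (_ : pi * _ / _ = 2 * ellipticK m); last first.
  by move: (pi : R) pi0 => p p0; field; rewrite gt_eqF.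
have e1 : ln (1 + m) <= m by rewrite -ler_expR lnK ?posrE ?addr_gt0// expR_ge1Dx.
have e2 : - ln l <= l^-1.
  rewrite -lnV ?posrE//; apply: (@le_trans _ _ (1 + l^-1 - 1)); last by lra.
  rewrite -ler_expR lnK ?posrE ?invr_gt0// (_ : 1 + _ - 1 = l^-1); last by ring.
  by apply: le_trans (expR_ge1Dx _); rewrite lerDr.
have e3 : m^-1 <= 1 + l ^+ 2.
  rewrite -[leLHS]mul1r ler_pdivrMr//.
  rewrite -(@ler_pXn2r _ 2) ?nnegrE ?mulr_ge0 ?addr_ge0 ?sqr_ge0 ?(ltW m0)//.
  rewrite exprMn m2 expr1n -subr_ge0.
  rewrite (_ : _ - _ = l ^+ 2 * (1 - l ^+ 2 - l ^+ 2 * l ^+ 2)); last by ring.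
  have l4 : l ^+ 2 <= 2^-1 * 2^-1 by rewrite expr2 ler_pM// ltW.
  have l44 : l ^+ 2 * l ^+ 2 <= 1 * 1 * 2^-1.
    by rewrite mul1r mulrC -[leRHS]mulr1 ler_pM ?sqr_ge0//; lra.
  by rewrite mulr_ge0 ?sqr_ge0//; lra.
have e4 : (ln (1 + m)) / m <= 1 by rewrite ler_pdivrMr// mul1r.
have lnl : 0 <= - ln l by rewrite oppr_ge0 ln_le0// ltW.
have e5 : - ln l / m <= - ln l + 2^-1.
  apply: (@le_trans _ _ (- ln l * (1 + l ^+ 2))); first by rewrite ler_wpM2l.
  rewrite mulrDr mulr1 lerD2l; apply: (@le_trans _ _ (l^-1 * l ^+ 2)).
    by rewrite ler_wpM2r ?sqr_ge0.
  rewrite (_ : l^-1 * l ^+ 2 = l)//; field.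
  by rewrite gt_eqF.
rewrite mulrDl in h2; lra.
Qed.

(** The solution is x = (1 - l') / (1 + l') with l' the complementary modulus,
    written here as the square of l / (1 + l'). *)
Lemma landen_descent l : 0 < l < 1 ->
  exists x, [/\ 0 < x < 1, x <= l ^+ 2 & 2 * Num.sqrt x / (1 + x) = l].
Proof.
move=> l01; have [m0 m1 m2] := compl_modulus l01; have /andP[l0 l1] := l01.
set m := Num.sqrt (1 - l ^+ 2) in m0 m1 m2 *.
have mp0 : 0 < 1 + m by rewrite addr_gt0.
exists ((l / (1 + m)) ^+ 2).
have q0 : 0 < l / (1 + m) by rewrite divr_gt0.
have q1 : l / (1 + m) <= l by rewrite ler_pdivrMr// ler_peMr ?(ltW l0)// lerDl ltW.
split.
- by rewrite exprn_gt0//= exprn_ilt1 ?(ltW q0)// (le_lt_trans q1).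
- by rewrite ler_pXn2r ?nnegrE ?(ltW q0) ?(ltW l0).
- rewrite sqrtr_sqr ger0_norm ?(ltW q0)// expr_div_n.
  have -> : l ^+ 2 = (1 - m) * (1 + m) by rewrite -subr_sqr expr1n m2; ring.
  by field; rewrite gt_eqF//= (_ : _ + _ = 2) ?pnatr_eq0//; ring.
Qed.

(** On a logarithmic scale the ascending transformation at least halves
    distances. *)
Lemma landen_contract x y : 0 < x < 1 -> 0 < y < 1 ->
  2 * Num.sqrt x / (1 + x) <= 2 * Num.sqrt y / (1 + y) ->
  x <= y /\ ((2 * Num.sqrt y / (1 + y)) / (2 * Num.sqrt x / (1 + x))) ^+ 2 <= y / x.
Proof.
move=> /andP[x0 x1] /andP[y0 y1] h.
have xp0 : 0 < 1 + x by rewrite addr_gt0.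
have yp0 : 0 < 1 + y by rewrite addr_gt0.
have sx0 : 0 < Num.sqrt x by rewrite sqrtr_gt0.
have sy0 : 0 < Num.sqrt y by rewrite sqrtr_gt0.
have phi2 z : 0 < z -> (2 * Num.sqrt z / (1 + z)) ^+ 2 = 4 * z / (1 + z) ^+ 2.
  move=> z0; rewrite expr_div_n exprMn sqr_sqrtr ?(ltW z0)//; congr (_ * _ / _); ring.
have xy : x <= y.
  have : (2 * Num.sqrt x / (1 + x)) ^+ 2 <= (2 * Num.sqrt y / (1 + y)) ^+ 2.
    by rewrite ler_pXn2r ?nnegrE ?divr_ge0 ?mulr_ge0 ?(ltW sx0) ?(ltW sy0) ?(ltW xp0) ?(ltW yp0).
  rewrite !phi2// ler_pdivrMr ?exprn_gt0// mulrAC ler_pdivlMr ?exprn_gt0//.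
  rewrite -subr_ge0 (_ : _ - _ = 4 * ((y - x) * (1 - x * y))); last by ring.
  rewrite pmulr_rge0// pmulr_lge0 ?subr_ge0// subr_gt0.
  by rewrite (lt_trans _ x1)// gtr_pMr.
split=> //; rewrite expr_div_n !phi2//.
rewrite (_ : _ / _ = (y / x) * ((1 + x) ^+ 2 / (1 + y) ^+ 2)); last first.
  by field; rewrite !gt_eqF.
rewrite ler_piMr ?divr_ge0 ?(ltW x0) ?(ltW y0)// ler_pdivrMr ?exprn_gt0// mul1r.
by rewrite ler_pXn2r ?nnegrE ?(ltW xp0) ?(ltW yp0)// lerD2l.
Qed.

Lemma landen_iterate n l m : 0 < l -> l <= m -> m < 1 ->
  exists l' m', [/\ 0 < l', l' <= m', m' <= m ^+ (2 ^ n),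
    period_ratio l' = 2 ^+ n * period_ratio l /\
    period_ratio m' = 2 ^+ n * period_ratio m &
    (m / l) ^+ (2 ^ n) <= m' / l'].
Proof.
elim: n l m => [|n IH] l m l0 lm m1.
  by exists l, m; rewrite expn0 !expr1 !expr0 !mul1r; split.
have m0 := lt_le_trans l0 lm; have l1 := le_lt_trans lm m1.
have [x [x01 xl xE]] : exists x, [/\ 0 < x < 1, x <= l ^+ 2 & 2 * Num.sqrt x / (1 + x) = l].
  by apply: landen_descent; rewrite l0.
have [y [y01 ym yE]] : exists x, [/\ 0 < x < 1, x <= m ^+ 2 & 2 * Num.sqrt x / (1 + x) = m].
  by apply: landen_descent; rewrite m0.
have [xy hc] : x <= y /\ (m / l) ^+ 2 <= y / x.
  by have := landen_contract x01 y01; rewrite xE yE; apply.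
have /andP[x0 _] := x01; have /andP[y0 y1] := y01.
have [l' [m' [h1 h2 h3 [h4 h5] h6]]] := IH x y x0 xy y1.
exists l', m'; split=> //.
- apply: le_trans h3 _; rewrite expnS exprM ler_pXn2r ?expn_gt0 ?nnegrE ?(ltW y0)//.
  by rewrite exprn_ge0 ?ltW.
- by rewrite h4 h5 (period_ratio_landen x01) (period_ratio_landen y01) xE yE exprSr -!mulrA.
- apply: le_trans h6; rewrite expnS exprM ler_pXn2r ?expn_gt0 ?nnegrE//.
    by rewrite exprn_ge0 ?divr_ge0 ?ltW.
  by rewrite divr_ge0 ?ltW.
Qed.

(** If two moduli had quotient c > 1 and the same period ratio, n descending steps
    would give small moduli of quotient at least c^(2^n), again with the same
    period ratio; but for small moduli this forces the quotient to be at most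
    exp(3). *)
Lemma period_ratio_inj l m : 0 < l < 1 -> 0 < m < 1 ->
  period_ratio l = period_ratio m -> l = m.
Proof.
wlog lm : l m / l <= m.
  move=> h l01 m01 e; have [lm|ml] := leP l m; first exact: h.
  by apply/esym/h => //; exact: ltW.
move=> /andP[l0 l1] /andP[m0 m1] e; apply/eqP; rewrite eq_le lm/=.
rewrite leNgt; apply/negP => lm'.
have c1 : l / m < 1 by rewrite ltr_pdivrMr// mul1r.
have c0 : 0 < l / m by rewrite divr_gt0.
have e30 : 0 < expR (- 3) :> R by exact: expR_gt0.
have lim1 : (l / m) ^+ N @[N --> \oo] --> (0 : R).
  by apply: cvg_expr; rewrite ger0_norm// ltW.
have lim2 : m ^+ N @[N --> \oo] --> (0 : R).
  by apply: cvg_expr; rewrite ger0_norm// ltW.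
have := filterI (cvgr_lt 0 lim1 _ e30) (cvgr_lt 0 lim2 (2^-1) ltac:(by rewrite invr_gt0)).
move=> [N _ hN].
have [/= b1 b2] := hN (2 ^ N)%N (ltnW (ltn_expl N (leqnn 2))).
have [l' [m' [l0' lm1 mm [N1 N2] q]]] := landen_iterate N l0 lm m1.
have m2 : m' <= 2^-1 by apply: le_trans mm (ltW b2).
have m0' := lt_le_trans l0' lm1.
have l01 : 0 < l' < 1 by rewrite l0'/=; lra.
have g1 := period_ratio_ge l01; have g2 := period_ratio_le m0' m2.
have : ln m' - ln l' <= 3 by rewrite N1 e -N2 in g1; lra.
rewrite -ln_div ?posrE// -ler_expR lnK ?posrE ?divr_gt0// => q3.
have := le_trans q q3; apply/negP; rewrite -ltNge.
rewrite -ltf_pV2 ?posrE ?expR_gt0 ?exprn_gt0 ?divr_gt0//.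
by rewrite -expRN -exprVn invf_div.
Qed.
End PeriodRatio.

(** * The nome of a modulus *)

Section ThetaInversion.
Variable R : realType.
Implicit Types (s l r : R).

Lemma theta_modulus_itv s : 0 < s < 1 -> 0 < theta_ratio s 1 ^+ 2 < 1.
Proof.
move=> /andP[s0 s1]; have x0 := theta_ratio_gt0 s0 s1 ltr01.
by rewrite exprn_gt0//= exprn_ilt1// ?(ltW x0)// theta_ratio1_lt1.
Qed.

Lemma theta_ratio1_period_step s n : 0 < s < 1 ->
  period_ratio (theta_ratio (s ^+ (2 ^ n)) 1 ^+ 2) =
  2 ^+ n * period_ratio (theta_ratio s 1 ^+ 2).
Proof.
move=> s01; elim: n => [|n IH]; first by rewrite expn0 expr1 expr0 mul1r.
have /andP[s0 s1] := s01.
have t0 : 0 < s ^+ (2 ^ n) by rewrite exprn_gt0.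
have t1 : s ^+ (2 ^ n) < 1 by rewrite exprn_ilt1 ?(ltW s0)// -lt0n expn_gt0.
have t20 : 0 < s ^+ (2 ^ n.+1) by rewrite exprn_gt0.
have t21 : s ^+ (2 ^ n.+1) < 1 by rewrite exprn_ilt1 ?(ltW s0)// -lt0n expn_gt0.
have x01 : 0 < theta_ratio (s ^+ (2 ^ n.+1)) 1 ^+ 2 < 1.
  by apply: theta_modulus_itv; rewrite t20.
have x0 := theta_ratio_gt0 t20 t21 ltr01.
rewrite (period_ratio_landen x01) sqrtr_sqr (ger0_norm (ltW x0)).
by rewrite expnSr exprM -theta_ratio1_landen// IH mulrA -exprS.
Qed.

(** Replacing s by s^(2^n) multiplies both sides by 2^n, while for small nomes
    their difference is bounded by C. *)
Lemma period_ratio_theta s : 0 < s < 1 ->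
  period_ratio (theta_ratio s 1 ^+ 2) = - (4 * ln s).
Proof.
move=> s01; have /andP[s0 s1] := s01.
set P := period_ratio _.
(* 4 ln 8 comes from theta_ratio t 1 <= 8 t, and 6 from period_ratio_le *)
pose C := 4 * ln 8 + 6 : R.
have lnX (x : R) : 0 < x -> ln (x ^+ 2) = 2 * ln x by move=> x0; rewrite lnXn// mulr_natl.
have bound n : s ^+ (2 ^ n) <= 16^-1 -> `|2 ^+ n * (P + 4 * ln s)| <= C.
  set t := s ^+ _ => t16.
  have t0 : 0 < t by rewrite exprn_gt0.
  have t1 : t < 1 by lra.
  have lnt : ln t = 2 ^+ n * ln s by rewrite lnXn// -[LHS]mulr_natl natrX.
  have step := theta_ratio1_period_step n s01; rewrite -/t -/P in step.
  have x0 := theta_ratio_gt0 t0 t1 ltr01.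
  have xge := theta_ratio1_ge t0 t1.
  have xle : theta_ratio t 1 <= 8 * t by apply: theta_ratio1_le => //; lra.
  set x := theta_ratio t 1 in step x0 xge xle.
  have x2 : 0 < x ^+ 2 by rewrite exprn_gt0.
  have xhalf : x <= 2^-1 by lra.
  have x22 : x ^+ 2 <= 2^-1.
    by rewrite expr2; apply: le_trans xhalf; rewrite ler_piMr ?(ltW x0)//; lra.
  have x21 : 0 < x ^+ 2 < 1 by rewrite x2/=; lra.
  have g1 := period_ratio_ge x21; have g2 := period_ratio_le x2 x22.
  rewrite lnX// step in g1; rewrite lnX// step in g2.
  have l1 : ln t <= ln x by rewrite ler_ln ?posrE.
  have l2 : ln x <= ln 8 + ln t.
    rewrite -lnM ?posrE// ler_ln ?posrE//; exact: mulr_gt0.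
  have l8 : 0 <= ln 8 :> R by rewrite ln_ge0// ler1n.
  rewrite mulrDr [2 ^+ n * (4 * _)]mulrCA -lnt ler_norml /C.
  by apply/andP; split; lra.
apply/eqP; rewrite -subr_eq0 opprK -normr_eq0 eq_le normr_ge0 andbT.
apply/ler_addgt0Pl => e e0; rewrite addr0.
have lim1 : s ^+ N @[N --> \oo] --> (0 : R) by apply: cvg_expr; rewrite ger0_norm// ltW.
have lim2 : (2^-1 : R) ^+ N @[N --> \oo] --> (0 : R).
  by apply: cvg_expr; rewrite ger0_norm// invf_lt1// ltr1n.
have C0 : 0 < C by rewrite ltr_pwDr// mulr_ge0// ln_ge0// ler1n.
have i16 : 0 < 16^-1 :> R by rewrite invr_gt0.
have eC : 0 < e / C by rewrite divr_gt0.
have := filterI (cvgr_lt 0 lim1 _ i16) (cvgr_lt 0 lim2 _ eC).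
move=> [N _ hN].
have [/= b1 _] := hN (2 ^ N)%N (ltnW (ltn_expl N (leqnn 2))).
have [/= _ b2] := hN N (leqnn N).
have h := bound N (ltW b1).
rewrite normrM ger0_norm ?exprn_ge0// in h.
have p2 : 0 < 2 ^+ N :> R by rewrite exprn_gt0.
rewrite mulrC -ler_pdivlMr// in h; apply: le_trans h _.
by rewrite mulrC -ler_pdivlMr// ltW// -exprVn.
Qed.

Lemma theta_ratio_period l : 0 < l < 1 ->
  theta_ratio (expR (- (period_ratio l / 4))) 1 ^+ 2 = l.
Proof.
move=> l01; have s01 : 0 < expR (- (period_ratio l / 4)) < 1.
  by rewrite expR_gt0/= -expR0 ltr_expR oppr_lt0 divr_gt0 ?period_ratio_gt0.
apply: period_ratio_inj => //; first exact: theta_modulus_itv.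
by rewrite period_ratio_theta// expRK; field.
Qed.

(** H_r(1)^2 is the complement of the modulus X_u(1)^2 with u^4 = r; passing to
    the complement turns N into pi^2 / N. *)
Lemma theta_imaginary_transformation r : 0 < r < 1 ->
  theta_quot r 1 ^+ 2 = theta_ratio (expR (pi ^+ 2 / (4 * ln r))) 1 ^+ 2.
Proof.
move=> /andP[r0 r1]; have lnr : ln r < 0 by rewrite ln_lt0// r0.
pose u := expR (ln r / 4).
have u01 : 0 < u < 1 by rewrite expR_gt0/= -expR0 ltr_expR pmulr_llt0.
have u4 : u ^+ 4 = r.
  by rewrite /u -expRM_natl (_ : _ * _ = ln r) ?lnK ?posrE//; field.
have /andP[u0 u1] := u01.
have pyth := theta_nullwerte_pythagoras u0 u1; rewrite u4 in pyth.
have h0 := theta_quot1_gt0 r0 r1.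
pose l := theta_quot r 1 ^+ 2; pose c := theta_ratio u 1 ^+ 2.
have l01 : 0 < l < 1.
  by rewrite exprn_gt0//= exprn_ilt1 ?(ltW h0)// theta_quot1_lt1.
have c01 : 0 < c < 1 by exact: theta_modulus_itv.
have lc : Num.sqrt (1 - c ^+ 2) = l.
  rewrite -pyth -/c -/l addrC addKr sqrtr_sqr ger0_norm// ltW//.
  by case/andP: l01.
have Nl : period_ratio l = - (pi ^+ 2 / ln r).
  rewrite -lc period_ratio_compl// period_ratio_theta// /u expRK.
  move: (pi : R) => p; field; by rewrite lt_eqF.
rewrite -[LHS](theta_ratio_period l01) Nl; congr (theta_ratio (expR _) 1 ^+ 2).
move: (pi : R) => p; field; by rewrite lt_eqF.
Qed.

End ThetaInversion.

(** * Polynomials with alternating values *)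

Lemma prodrN_seq (R : comNzRingType) (I : Type) (s : seq I) (F : I -> R) :
  \prod_(j <- s) - F j = (-1) ^+ size s * \prod_(j <- s) F j.
Proof.
elim: s => [|j s IH]; first by rewrite !big_nil mulr1.
by rewrite !big_cons IH /= exprS; ring.
Qed.

(** In the Lagrange form, the coefficient of degree n of D, which is 0, is a sum
    of the values D(t_i) divided by the products of the differences t_i - t_j.
    These products alternate in sign like the values, so all terms have the same
    sign and must vanish. *)
Lemma alternating_poly_eq0 (R : realFieldType) (n : nat) (D : {poly R}) (t : nat -> R) :
  (size D <= n)%N -> (forall i j, (i < j <= n)%N -> t i < t j) ->
  (forall i, (i <= n)%N -> 0 <= (-1) ^+ i * D.[t i]) -> D.[t 0] = 0.
Proof.
move=> sD tlt alt.
pose idx i := iota 0 i ++ iota i.+1 (n - i).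
pose ell i : {poly R} := \prod_(x <- map t (idx i)) ('X - x%:P).
have mem_idx i j : (i <= n)%N -> (j \in idx i) = (j <= n)%N && (j != i).
  by move=> ? ; rewrite mem_cat !mem_iota; lia.
have szidx i : (i <= n)%N -> size (idx i) = n.
  by move=> ?; rewrite size_cat !size_iota; lia.
have t_inj i j : (i <= n)%N -> (j <= n)%N -> i != j -> t i != t j.
  move=> ? ? ij; have [h|h] : (i < j)%N \/ (j < i)%N by lia.
    by rewrite lt_eqF// tlt//; lia.
  by rewrite gt_eqF// tlt//; lia.
pose w i := (ell i).[t i].
have wsign i : (i <= n)%N -> 0 < (-1) ^+ (n - i) * w i.
  move=> ni; rewrite /w /ell big_map horner_prod big_cat/= mulrCA.
  rewrite mulr_gt0//.
    rewrite big_seq prodr_gt0// => j; rewrite mem_iota => hj.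
    by rewrite hornerXsubC subr_gt0 tlt//; lia.
  under eq_bigr do rewrite hornerXsubC -opprB.
  rewrite prodrN_seq size_iota mulrA -exprMn mulrNN mulr1 expr1n mul1r.
  rewrite big_seq prodr_gt0// => j; rewrite mem_iota => hj.
  by rewrite subr_gt0 tlt//; lia.
have wn0 i : (i <= n)%N -> w i != 0.
  by move=> ni; apply/eqP => h; have := wsign i ni; rewrite h mulr0 ltxx.
have ell0 i m : (i <= n)%N -> (m <= n)%N -> m != i -> (ell i).[t m] = 0.
  move=> ni nm mi; apply/eqP; rewrite -/(root _ _) root_prod_XsubC.
  by rewrite map_f// mem_idx// nm.
pose L := \sum_(i < n.+1) (D.[t i] / w i) *: ell i.
have DL : D = L.
  apply/eqP; rewrite -subr_eq0; apply/eqP.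
  apply: (@roots_geq_poly_eq0 _ _ (map t (iota 0 n.+1))).
  - apply/allP => x /mapP[m]; rewrite mem_iota add0n ltnS => /andP[_ nm] ->.
    rewrite /root hornerD hornerN /L horner_sum (bigD1 (inord m))//=.
    rewrite inordK// hornerZ -/(w m) divfK ?wn0// big1 ?addr0 ?subrr// => i im.
    have ni : (i <= n)%N by rewrite -ltnS.
    rewrite hornerZ ell0 ?mulr0//.
    by apply: contra_neq im => ->; rewrite inord_val.
  - rewrite map_inj_in_uniq ?iota_uniq// => i j; rewrite !mem_iota => hi hj e.
    apply/eqP; apply: contra_eqT e => ij; apply: t_inj => //; lia.
  - rewrite size_map size_iota (leq_trans (size_polyD _ _))// size_polyN geq_max.
    rewrite (leq_trans sD)//= (leq_trans (size_sum _ _ _))//.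
    apply/bigmax_leqP => i _; apply: leq_trans (size_scale_leq _ _) _.
    have ni : (i <= n)%N by rewrite -ltnS.
    by rewrite size_prod_XsubC size_map szidx.
have sum0 : \sum_(i < n.+1) D.[t i] / w i = 0.
  have : L`_n = 0 by rewrite -DL nth_default.
  rewrite /L coef_sum => L0; rewrite -[RHS]L0; apply: eq_bigr => i _.
  rewrite coefZ -[LHS]mulr1; congr (_ * _); apply/esym.
  have ni : (i <= n)%N by rewrite -ltnS.
  have := monic_prod_XsubC (map t (idx i)) xpredT id.
  rewrite qualifE/= /lead_coef size_prod_XsubC size_map szidx//= => /eqP.
  by [].
have term_ge0 (i : 'I_n.+1) : 0 <= (-1) ^+ n * (D.[t i] / w i).
  have ni : (i <= n)%N by rewrite -ltnS.
  have := alt i ni; have := wsign i ni.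
  have -> : (-1) ^+ n = (-1) ^+ i * (-1) ^+ (n - i) :> R by rewrite -exprD subnKC.
  have : (-1) ^+ (n - i) * (-1) ^+ (n - i) = 1 :> R.
    by rewrite -exprMn mulrNN mulr1 expr1n.
  move: ((-1) ^+ (n - i)) ((-1) ^+ i) => e f ee ew fD.
  have en0 : e != 0 by apply/eqP => e0; move: ee; rewrite e0 mul0r => /eqP; rewrite eq_sym oner_eq0.
  have -> : f * e * (D.[t i] / w i) = (f * D.[t i]) / (e * w i) * (e * e).
    by field; rewrite wn0// en0.
  by rewrite ee mulr1 divr_ge0// ltW.
have : \sum_(i < n.+1) (-1) ^+ n * (D.[t i] / w i) = 0 by rewrite -mulr_sumr sum0 mulr0.
move/eqP; rewrite psumr_eq0// => /allP /(_ ord0 (mem_index_enum _)) /=.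
rewrite mulf_eq0 signr_eq0/= mulf_eq0 invr_eq0 (negbTE (wn0 0%N _))// orbF.
by move/eqP.
Qed.

(** * Upper and lower bounds for a Zolotarev number *)

Section ComplexPolynomialOnRealLine.
Variable R : realType.
Implicit Types (p q : {poly R[i]}) (x : R).

(** For real x the value of this real polynomial is |p(x)|^2, which makes the
    comparison with a complex competitor a real problem. *)
Definition normsq_poly p : {poly R} :=
  (\poly_(i < size p) complex.Re p`_i) ^+ 2 + (\poly_(i < size p) complex.Im p`_i) ^+ 2.

Lemma normc_sq (z : R[i]) : ComplexField.Normc.normc z ^+ 2 =
  complex.Re z ^+ 2 + complex.Im z ^+ 2.
Proof. by case: z => u v /=; rewrite sqr_sqrtr// addr_ge0 ?sqr_ge0. Qed.

Lemma normc_ge0 (z : R[i]) : 0 <= ComplexField.Normc.normc z.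
Proof. by case: z => u v /=; exact: sqrtr_ge0. Qed.

Lemma normsq_polyE p x :
  (normsq_poly p).[x] = ComplexField.Normc.normc p.[(x%:C)%C] ^+ 2.
Proof.
rewrite normc_sq hornerD !horner_exp !horner_poly horner_coef.
have ReD : {morph (@complex.Re R) : u v / u + v} by move=> [? ?] [? ?].
have ImD : {morph (@complex.Im R) : u v / u + v} by move=> [? ?] [? ?].
rewrite (big_morph (@complex.Re R) ReD (erefl _)).
rewrite (big_morph (@complex.Im R) ImD (erefl _)).
have ReM (z : R[i]) (y : R) : complex.Re (z * (y%:C)%C) = complex.Re z * y.
  by case: z => u v /=; rewrite mulr0 subr0.
have ImM (z : R[i]) (y : R) : complex.Im (z * (y%:C)%C) = complex.Im z * y.
  by case: z => u v /=; rewrite mulr0 add0r.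
congr (_ ^+ 2 + _ ^+ 2); apply: eq_bigr => i _.
  by rewrite -rmorphXn ReM.
by rewrite -rmorphXn ImM.
Qed.

Lemma size_sq_leq (p : {poly R}) k : (size p <= k.+1)%N -> (size (p ^+ 2)%R <= (2 * k).+1)%N.
Proof.
move=> pk; apply: leq_trans (size_polyMleq _ _) _; lia.
Qed.

Lemma size_mul_leq (p q : {poly R}) k : (size p <= (2 * k).+1)%N ->
  (size q <= (2 * k).+1)%N -> (size (p * q)%R <= (4 * k).+1)%N.
Proof.
by move=> pk qk; apply: leq_trans (size_polyMleq _ _) _; lia.
Qed.

Lemma size_normsq_poly p k : (size p <= k.+1)%N -> (size (normsq_poly p) <= (2 * k).+1)%N.
Proof.
move=> pk; apply: leq_trans (size_polyD _ _) _; rewrite geq_max.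
by apply/andP; split; apply: size_sq_leq; apply: leq_trans (size_poly _ _) pk.
Qed.

End ComplexPolynomialOnRealLine.

Section ZolotarevBounds.
Variables (R : realType) (k : nat) (a b m : R).
Hypotheses (ha : 0 < a) (hab : a < b) (hm : 0 < m).
Variables (p0 q0 : {poly R}).
Hypotheses (sp0 : (size p0 <= k.+1)%N) (sq0 : (size q0 <= k.+1)%N).
Hypothesis sym : forall x, q0.[x] ^+ 2 = p0.[- x] ^+ 2.

Let E := real_segment (- b) (- a).
Let F := real_segment a b.

Let sym' x : p0.[x] ^+ 2 = q0.[- x] ^+ 2.
Proof. by rewrite sym opprK. Qed.

Let absE (r : {poly R[i]} * {poly R[i]}) x : ~~ root r.2 (x%:C)%C ->
  ratfun_abs r (x%:C)%C =
  (ComplexField.Normc.normc r.1.[(x%:C)%C] / ComplexField.Normc.normc r.2.[(x%:C)%C])%:E.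
Proof.
move=> h; rewrite /ratfun_abs (negbTE h) ComplexField.Normc.normcM.
by rewrite ComplexField.Normc.normcV.
Qed.

Let abs_ge0 (r : {poly R[i]} * {poly R[i]}) z : (0 <= ratfun_abs r z)%E.
Proof. by rewrite /ratfun_abs; case: ifP => // _; rewrite lee_fin normc_ge0. Qed.

(** By the symmetry of p0 and q0 the bound m on [-b, -a] is the bound 1 / m from
    below on [a, b]. *)
Lemma zolotarev_le : q0 != 0 -> coprimep p0 q0 ->
  (forall x, - b <= x <= - a -> q0.[x] != 0 /\ p0.[x] ^+ 2 <= m ^+ 2 * q0.[x] ^+ 2) ->
  (zolotarev k E F <= (m ^+ 2)%:E)%E.
Proof.
move=> q0n cop bound.
pose emb := real_complex R.
pose r := (map_poly emb p0, map_poly emb q0).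
have rootE x : root r.2 (x%:C)%C = (q0.[x] == 0).
  by rewrite /root horner_map fmorph_eq0.
have rE x : q0.[x] != 0 -> ratfun_abs r (x%:C)%C = (`|p0.[x]| / `|q0.[x]|)%:E.
  move=> qx; rewrite absE ?rootE// !horner_map /=.
  by rewrite !expr0n /= !addr0 !sqrtr_sqr.
have sq_le x y c : 0 < c -> x ^+ 2 <= c ^+ 2 * y ^+ 2 -> `|x| <= c * `|y| :> R.
  move=> c0 h; rewrite -(@ler_pXn2r _ 2) ?nnegrE ?mulr_ge0 ?(ltW c0)//.
  by rewrite exprMn !real_normK ?num_real.
have supE : (zolo_sup E r <= m%:E)%E.
  apply: ge_ereal_sup => _ [z [x /= xE <-] <-]; rewrite in_itv/= in xE.
  have [qx px] := bound x xE; rewrite rE// lee_fin ler_pdivrMr ?normr_gt0//.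
  exact: sq_le.
have infF : ((m^-1)%:E <= zolo_inf F r)%E.
  apply: le_ereal_inf_tmp => _ [z [x /= xF <-] <-]; rewrite in_itv/= in xF.
  have [qx|qx] := eqVneq q0.[x] 0.
    by rewrite /ratfun_abs rootE qx eqxx leey.
  have xE : - b <= - x <= - a by rewrite !lerN2 andbC.
  have [_ px] := bound (- x) xE.
  rewrite rE// lee_fin ler_pdivlMr ?normr_gt0// mulrC ler_pdivrMr// mulrC.
  by apply: sq_le => //; rewrite sym' [leLHS]sym.
have sup0 : (0 <= zolo_sup E r)%E.
  apply: le_trans (abs_ge0 r ((- a)%:C)%C) _; apply: ereal_sup_ubound.
  by exists ((- a)%:C)%C => //; exists (- a) => //=; rewrite in_itv/= lerN2 lexx ltW.
apply: ge_ereal_inf; exists (zolo_sup E r / zolo_inf F r)%E.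
  exists r => //; split; last first.
  - by apply: lt_le_trans infF; rewrite lte_fin invr_gt0.
  - by apply: le_lt_trans supE _; exact: ltry.
  - split=> /=; rewrite ?map_poly_eq0// ?coprimep_map// ?size_map_poly//.
case: (zolo_inf F r) infF => [B|_|//]; last first.
  by rewrite /inve mule0 lee_fin exprn_ge0// ltW.
rewrite lee_fin => mB; have B0 : 0 < B by apply: lt_le_trans mB; rewrite invr_gt0.
rewrite inver gt_eqF//.
case: (zolo_sup E r) supE sup0 => [A|//|//]; rewrite !lee_fin => Am A0.
rewrite expr2 ler_pM ?invr_ge0 ?(ltW B0)//.
by rewrite -[m]invrK lef_pV2 ?posrE ?invr_gt0.
Qed.

(** Suppose that p / q has sup A and inf B with A / B < m^2. The polynomial
    D = (B m)^2 p0^2 |q|^2 - q0^2 |p|^2 is positive at the even points e_(2i),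
    nonpositive at the odd ones (zeros of p0), and by symmetry nonpositive,
    respectively nonnegative, at their opposites. These are 4k + 2 points, and
    the degree is at most 4k. *)
Lemma zolotarev_ge (e : nat -> R) :
  (forall i j, (i < j <= 2 * k)%N -> e i < e j) ->
  (forall i, (i <= 2 * k)%N -> - b <= e i <= - a) ->
  (forall i, (i <= k)%N -> q0.[e (2 * i)%N] != 0 /\
    p0.[e (2 * i)%N] ^+ 2 = m ^+ 2 * q0.[e (2 * i)%N] ^+ 2) ->
  (forall i, (i < k)%N -> p0.[e (2 * i).+1] = 0) ->
  ((m ^+ 2)%:E <= zolotarev k E F)%E.
Proof.
have n_dbl i : (i <= k)%N -> (2 * i <= 2 * k)%N by rewrite leq_mul2l.
have n_high i j : (i < j <= (4 * k).+1)%N -> (2 * k < i)%N ->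
    (4 * k + 1 - j < 4 * k + 1 - i <= 2 * k)%N by lia.
have n_refl i : (2 * k < i)%N -> (4 * k + 1 - i <= 2 * k)%N by lia.
have n_odd i : (i <= 2 * k)%N -> odd i -> (i./2 < k)%N /\ i = (2 * i./2).+1.
  by move=> ik oi; have := odd_double_half i; rewrite oi; lia.
have n_even i : (i <= 2 * k)%N -> ~~ odd i -> (i./2 <= k)%N /\ i = (2 * i./2)%N.
  by move=> ik /negbTE oi; have := odd_double_half i; rewrite oi; lia.
have n_sign i : (i <= (4 * k).+1)%N -> odd (4 * k + 1 - i) = ~~ odd i.
  by move=> ik; rewrite oddB ?addn1// oddS oddM/= ; case: (odd i).
move=> einc eE heven hodd; apply: le_ereal_inf_tmp => _ [[p q]] [[/= qn0 _ sp sq] supE infF] <-.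
set S := zolo_sup E _ in supE *; set I := zolo_inf F _ in infF *.
have e0E := eE 0%N (leq0n _).
have S_ge x : - b <= x <= - a -> (ratfun_abs (p, q) (x%:C)%C <= S)%E.
  move=> xE; apply: ereal_sup_ubound; exists (x%:C)%C => //.
  by exists x => //=; rewrite in_itv.
have I_le x : a <= x <= b -> (I <= ratfun_abs (p, q) (x%:C)%C)%E.
  move=> xF; apply: ereal_inf_lbound; exists (x%:C)%C => //.
  by exists x => //=; rewrite in_itv.
have [A SA] : exists A, S = A%:E.
  have S0 : (0 <= S)%E by apply: le_trans (S_ge _ e0E); exact: abs_ge0.
  by exists (fine S); rewrite fineK// ge0_fin_numE.
have A0 : 0 <= A.
  by rewrite -lee_fin -SA; apply: le_trans (S_ge _ e0E); exact: abs_ge0.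
have mE i : (i <= 2 * k)%N -> a <= - e i <= b.
  by move=> ik; have /andP[h1 h2] := eE i ik; rewrite lerNr h2 lerNl h1.
have [x1 x1F x1q] : exists2 x, a <= x <= b & ~~ root q (x%:C)%C.
  apply: contrapT => h.
  have rt x : a <= x <= b -> root q (x%:C)%C.
    by move=> xF; apply: contrapT => /negP rq; apply: h; exists x.
  have : q = 0.
    apply: (@roots_geq_poly_eq0 _ _ (map (fun i => ((a + i%:R * ((b - a) / k.+1%:R))%:C)%C) (iota 0 k.+1))).
    - rewrite all_map; apply/allP => i; rewrite mem_iota add0n ltnS => /andP[_ ik] /=.
      apply: rt; have d0 : 0 < (b - a) / k.+1%:R by rewrite divr_gt0 ?subr_gt0.
      rewrite lerDl mulr_ge0 ?(ltW d0)//= -lerBrDl mulrC -mulrA ler_piMr ?subr_ge0 ?(ltW hab)//.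
      by rewrite mulrC ler_pdivrMr// mul1r ler_nat ltnW.
    - rewrite map_inj_uniq ?iota_uniq// => i j [] /addrI /mulIf h'.
      by apply/eqP; rewrite -(eqr_nat R); apply/eqP/h'; rewrite gt_eqF// divr_gt0 ?subr_gt0.
    - by rewrite size_map size_iota.
  by move/eqP; rewrite (negbTE qn0).
have [B IB] : exists B, I = B%:E.
  exists (fine I); rewrite fineK// ge0_fin_numE ?(ltW infF)//.
  by apply: le_lt_trans (I_le _ x1F) _; rewrite absE// ltry.
have B0 : 0 < B by rewrite -lte_fin -IB.
rewrite SA IB inver gt_eqF// -EFinM lee_fin leNgt; apply/negP.
rewrite ltr_pdivrMr// => AB.
pose P := normsq_poly p; pose Q := normsq_poly q.
have PE x : P.[x] = _ := normsq_polyE p x.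
have QE x : Q.[x] = _ := normsq_polyE q x.
have hE x : - b <= x <= - a -> 0 < Q.[x] /\ P.[x] <= A ^+ 2 * Q.[x].
  move=> xE; have := S_ge x xE; rewrite SA.
  have [rq|nrq] := boolP (root q (x%:C)%C).
    by rewrite /ratfun_abs/= rq.
  have q1 : 0 < ComplexField.Normc.normc q.[(x%:C)%C].
    rewrite lt_neqAle normc_ge0 andbT eq_sym; apply: contra nrq => /eqP h.
    by rewrite /root; apply/eqP/ComplexField.Normc.eq0_normc.
  rewrite absE//= lee_fin ler_pdivrMr// => h; rewrite PE QE exprn_gt0//; split=> //.
  by rewrite -exprMn ler_pXn2r ?nnegrE ?mulr_ge0 ?normc_ge0.
have hF x : a <= x <= b -> 0 <= Q.[x] /\ B ^+ 2 * Q.[x] <= P.[x].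
  move=> xF; have := I_le x xF; rewrite IB PE QE sqr_ge0; split=> //.
  rewrite -exprMn ler_pXn2r ?nnegrE ?mulr_ge0 ?normc_ge0 ?(ltW B0)//.
  have [rq|nrq] := boolP (root q (x%:C)%C).
    by rewrite (eqP rq) ComplexField.Normc.normc0 mulr0 normc_ge0.
  have q1 : 0 < ComplexField.Normc.normc q.[(x%:C)%C].
    rewrite lt_neqAle normc_ge0 andbT eq_sym; apply: contra nrq => /eqP h.
    by rewrite /root; apply/eqP/ComplexField.Normc.eq0_normc.
  move: (I_le x xF); rewrite IB absE//= lee_fin ler_pdivlMr//.
pose D := (B * m) ^+ 2 *: (p0 ^+ 2 * Q) - q0 ^+ 2 * P.
have DE x : D.[x] = (B * m) ^+ 2 * (p0.[x] ^+ 2 * Q.[x]) - q0.[x] ^+ 2 * P.[x].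
  by rewrite /D hornerD hornerN hornerZ !hornerM; ring.
have sD : (size D <= (4 * k).+1)%N.
  have s1 := size_sq_leq sp0; have s2 := size_sq_leq sq0.
  have s3 := size_normsq_poly sp; have s4 := size_normsq_poly sq.
  apply: leq_trans (size_polyD _ _) _; rewrite size_polyN geq_max; apply/andP; split.
    by apply: leq_trans (size_scale_leq _ _) _; exact: size_mul_leq s1 s4.
  exact: size_mul_leq s2 s3.
(* the points e_i followed by their opposites, in increasing order *)
pose t i := if (i <= 2 * k)%N then e i else - e (4 * k + 1 - i)%N.
have AB2 : A ^+ 2 < (B * m * m) ^+ 2.
  by rewrite ltr_pXn2r ?nnegrE ?mulr_ge0 ?(ltW B0) ?(ltW hm)// -mulrA -expr2 mulrC.
have DEeven i : (i <= k)%N -> 0 < D.[e (2 * i)%N].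
  move=> ik; have [q0n p0E] := heven i ik.
  have [Q0 PQ] := hE _ (eE (2 * i)%N (n_dbl i ik)).
  rewrite DE p0E subr_gt0.
  have q2 : 0 < q0.[e (2 * i)%N] ^+ 2 by rewrite exprn_even_gt0.
  apply: (@le_lt_trans _ _ (q0.[e (2 * i)%N] ^+ 2 * (A ^+ 2 * Q.[e (2 * i)%N]))).
    by rewrite ler_pM2l.
  rewrite [ltRHS](_ : _ = q0.[e (2 * i)%N] ^+ 2 * ((B * m * m) ^+ 2 * Q.[e (2 * i)%N])); last by ring.
  by rewrite ltr_pM2l// ltr_pM2r.
have : D.[t 0%N] = 0.
  apply: (@alternating_poly_eq0 _ (4 * k).+1) => //.
  - move=> i j ij; rewrite /t.
    have [i1|i1] := leqP i (2 * k); have [j1|j1] := leqP j (2 * k).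
    + by apply: einc; case/andP: ij => -> _.
    + have /andP[_ h1] := eE i i1.
      by have /andP[h2 _] := mE _ (n_refl j j1); have := ha; lra.
    + by case/andP: ij => ij _; have := leq_trans (ltn_trans i1 ij) j1; rewrite ltnn.
    + by rewrite ltrN2; apply: einc; exact: n_high.
  - move=> i i4; rewrite /t; have [i1|i1] := leqP i (2 * k).
      have [oi|ei] := boolP (odd i).
        have [ik ie] := n_odd i i1 oi; have [Q0 _] := hE _ (eE i i1).
        rewrite DE -signr_odd oi expr1 ie hodd// -ie expr0n /=.
        by rewrite mul0r mulr0 sub0r mulrNN mul1r mulr_ge0 ?sqr_ge0// PE sqr_ge0.
      have [ik ie] := n_even i i1 ei.
      by rewrite -signr_odd (negbTE ei) expr0 mul1r ie ltW// DEeven.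
    have jk := n_refl i i1; have sgn := n_sign i i4.
    move: (4 * k + 1 - i)%N jk sgn => j jk sgn.
    rewrite -signr_odd -[odd i]negbK -sgn.
    have [Q0 QP] := hF _ (mE j jk).
    rewrite DE -sym [q0.[- _] ^+ 2]sym opprK.
    have [oj|ej] := boolP (odd j).
      have [jh je] := n_odd j jk oj.
      rewrite /= expr0 mul1r je hodd// -je expr0n /= mul0r subr0.
      by rewrite mulr_ge0 ?sqr_ge0// mulr_ge0 ?sqr_ge0.
    have [jh je] := n_even j jk ej.
    have [q0n p0E] := heven (j./2) jh; rewrite -je in q0n p0E.
    rewrite /= expr1 mulN1r opprB p0E subr_ge0.
    rewrite [leLHS](_ : _ = (m ^+ 2 * q0.[e j] ^+ 2) * (B ^+ 2 * Q.[- e j])); last by ring.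
    by rewrite ler_wpM2l// mulr_ge0 ?sqr_ge0.
rewrite /t leq0n => D0; have := DEeven 0%N (leq0n _).
by rewrite muln0 D0 ltxx.
Qed.

End ZolotarevBounds.

(** * The extremal rational function *)

Section ZolotarevExtremal.
Variables (R : realType) (k : nat) (c r : R).
Hypotheses (k0 : (0 < k)%N) (c0 : 0 < c) (r0 : 0 < r) (r1 : r < 1).

Let q := r ^+ k.
Let q0 : 0 < q. Proof. by rewrite exprn_gt0. Qed.
Let q1 : q < 1. Proof. by rewrite exprn_ilt1 ?(ltW r0)// -lt0n. Qed.
Let X (z : R) := theta_ratio q z.
Let X0 z : 0 < z -> 0 < X z. Proof. by move=> z0; exact: theta_ratio_gt0. Qed.

(** Images of the odd powers of r, the zeros of the theta quotient of nome r;
    exponents above 2k would repeat them. *)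
Definition zolo_node (j : nat) : R := - (c * theta_ratio (r ^+ k) (r ^+ (2 * j).+1)).
Definition zolo_num : {poly R} := \prod_(j < k) ('X - (zolo_node j)%:P).
Definition zolo_den : {poly R} := \prod_(j < k) ('X - (- zolo_node j)%:P).

Lemma size_zolo_num : (size zolo_num <= k.+1)%N.
Proof. by rewrite size_prod_XsubC [index_enum _]unlock -enumT size_enum_ord. Qed.

Lemma size_zolo_den : (size zolo_den <= k.+1)%N.
Proof. by rewrite size_prod_XsubC [index_enum _]unlock -enumT size_enum_ord. Qed.

Lemma zolo_node_lt0 j : zolo_node j < 0.
Proof. by rewrite oppr_lt0 mulr_gt0// X0// exprn_gt0. Qed.

Lemma zolo_sym x : zolo_den.[x] ^+ 2 = zolo_num.[- x] ^+ 2.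
Proof.
rewrite !horner_prod -!prodrXl; apply: eq_bigr => j _.
by rewrite !hornerXsubC; ring.
Qed.

Lemma zolo_den_neq0 x : x < 0 -> zolo_den.[x] != 0.
Proof.
move=> x0; rewrite horner_prod; apply/prodf_neq0 => j _.
rewrite hornerXsubC opprK lt_eqF//; have := zolo_node_lt0 j; lra.
Qed.

Lemma coprime_zolo : coprimep zolo_num zolo_den.
Proof.
apply: (big_ind (fun p => coprimep zolo_num p)); first exact: coprimep1.
  by move=> p p' h h'; rewrite coprimepMr h.
move=> j _; rewrite coprimep_XsubC /root horner_prod; apply/prodf_neq0 => i _.
rewrite hornerXsubC subr_eq0 gt_eqF// (lt_trans (zolo_node_lt0 _))//.
by rewrite oppr_gt0 zolo_node_lt0.
Qed.

(** On the curve x = - c X(z) the rational function of degree k is, up to sign,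
    the theta quotient of nome r. *)
Lemma zolo_uniformization z : 0 < z ->
  zolo_num.[- (c * X z)] ^+ 2 =
  theta_quot r z ^+ 2 * zolo_den.[- (c * X z)] ^+ 2.
Proof.
move=> z0; rewrite (theta_quot_rational r0 r1 k0 z0) -exprMn -/q.
rewrite !horner_prod -big_split/= -!prodrXl; apply: eq_bigr => j _.
rewrite !hornerXsubC /zolo_node -/q -/(X _) -/(X _).
have := X0 z0; have := X0 (exprn_gt0 (2 * j).+1 r0).
move: (X _) (X _) => x y x0 y0; field.
by rewrite gt_eqF// addr_gt0.
Qed.

Lemma theta_quot_even_pow n : theta_quot r (r ^+ (2 * n)) ^+ 2 = theta_quot r 1 ^+ 2.
Proof.
elim: n => [|n IH]; first by rewrite muln0 expr0.
by rewrite mulnS exprD theta_quot_shift ?exprn_gt0// sqrrN.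
Qed.

(** Images of the powers of r from r^(2k) to 1, in increasing order: the points of
    even index are extremal, those of odd index are zeros. *)
Definition zolo_alt (i : nat) : R := - (c * theta_ratio (r ^+ k) (r ^+ (2 * k - i))).

Lemma theta_ratio_lt z w : 0 < z -> 0 < w ->
  theta_quot q w < theta_quot q z -> X z < X w.
Proof.
move=> z0 w0; rewrite /theta_quot -/(X z) -/(X w).
have := X0 z0; have := X0 w0; move: (X z) (X w) => x y y0 x0.
rewrite ltr_pdivrMr ?addr_gt0// mulrAC ltr_pdivlMr ?addr_gt0//; lra.
Qed.

Lemma zolo_alt_incr i j : (i < j <= 2 * k)%N -> zolo_alt i < zolo_alt j.
Proof.
move=> /andP[ij jk]; rewrite ltrN2 ltr_pM2l//.
have p n : 0 < r ^+ n by rewrite exprn_gt0.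
rewrite -theta_ratioV// -[ltRHS]theta_ratioV//; apply: theta_ratio_lt; rewrite ?invr_gt0//.
have le2 : (2 * k - j < 2 * k - i)%N by lia.
apply: theta_quot_anti => //.
- by rewrite invf_ge1// exprn_ile1// ltW.
- by rewrite ltf_pV2 ?posrE// ltr_iXn2l.
- by rewrite lef_pV2 ?posrE ?exprn_gt0// /q -exprM mulnC ler_wiXn2l ?(ltW r0) ?(ltW r1)// leq_subr.
Qed.

Lemma zolo_alt_itv i : (i <= 2 * k)%N ->
  - (c / X 1) <= zolo_alt i <= - (c * X 1).
Proof.
move=> ik.
have <- : zolo_alt 0 = - (c / X 1).
  rewrite /zolo_alt subn0 -/q; have -> : r ^+ (2 * k) = q ^+ 2 * 1.
    by rewrite mulr1 /q -exprM mulnC.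
  by rewrite theta_ratio_shift.
have <- : zolo_alt (2 * k) = - (c * X 1) by rewrite /zolo_alt subnn expr0.
apply/andP; split.
  by case: i ik => // i ik; rewrite ltW// zolo_alt_incr.
move: ik; rewrite leq_eqVlt => /orP[/eqP ->//|ik].
by rewrite ltW// zolo_alt_incr// ik leqnn.
Qed.

Lemma zolo_alt_node i : (i < k)%N -> zolo_num.[zolo_alt (2 * i).+1] = 0.
Proof.
move=> ik; apply/eqP; rewrite horner_prod prodf_seq_eq0; apply/hasP.
have jk : (k - i.+1 < k)%N by lia.
exists (Ordinal jk); rewrite ?mem_index_enum//= hornerXsubC /zolo_alt /zolo_node.
have -> : (2 * k - (2 * i).+1 = (2 * (k - i.+1)).+1)%N by lia.
by rewrite subrr.
Qed.

(** Any x of the interval is - c X(z) for some z, by surjectivity of the theta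
    quotient, and |H_r| is at most H_r(1). *)
Lemma zolo_bound x : - (c / X 1) <= x <= - (c * X 1) ->
  zolo_num.[x] ^+ 2 <= theta_quot r 1 ^+ 2 * zolo_den.[x] ^+ 2.
Proof.
move=> /andP[x1 x2]; have g0 := X0 ltr01.
pose y := - x / c.
have y1 : X 1 <= y by rewrite /y ler_pdivlMr// mulrC lerNr.
have y2 : y <= (X 1)^-1 by rewrite /y ler_pdivrMr// mulrC lerNl.
have y0 : 0 < y by apply: lt_le_trans y1.
have cn : c != 0 by rewrite gt_eqF.
have xE : x = - (c * y) by rewrite /y; field.
(* the value of the theta quotient at a point where the theta ratio is y *)
pose v := (1 - y) / (1 + y).
have v1 : `|v| <= theta_quot q 1.
  rewrite /theta_quot -/(X 1) ler_norml; apply/andP; split.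
    rewrite -mulNr ler_pdivrMr ?addr_gt0// mulrAC ler_pdivlMr ?addr_gt0//.
    have : y * X 1 <= 1 by rewrite -ler_pdivlMr// div1r.
    lra.
  by rewrite ler_pdivrMr ?addr_gt0// mulrAC ler_pdivlMr ?addr_gt0//; lra.
have [z [z1 z2 zE]] := theta_quot_surj q0 q1 v1.
have z0 : 0 < z by apply: lt_le_trans z1.
have yE : X z = y.
  rewrite /X theta_ratioE// zE /v; field.
  by rewrite gt_eqF ?addr_gt0//= (_ : _ + _ = 2) ?pnatr_eq0//; ring.
rewrite xE -yE zolo_uniformization// ler_wpM2r ?sqr_ge0//.
rewrite -[leLHS]real_normK ?num_real// ler_pXn2r ?nnegrE ?(ltW (theta_quot1_gt0 _ _))//.
apply: (@theta_quot_norm_le _ _ r0 r1 k); first by apply: le_trans (ltW r1) z1.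
apply: le_trans z2 _; rewrite /q -exprM mulnC ler_peMl ?invr_ge0 ?exprn_ge0 ?(ltW r0)//.
by rewrite invf_ge1// ltW.
Qed.

Lemma zolotarev_theta :
  zolotarev k (real_segment (- (c / X 1)) (- (c * X 1))) (real_segment (c * X 1) (c / X 1))
  = (theta_quot r 1 ^+ 2)%:E.
Proof.
have g0 := X0 ltr01; have g1 : X 1 < 1 by exact: theta_ratio1_lt1.
have a0 : 0 < c * X 1 by rewrite mulr_gt0.
have ab : c * X 1 < c / X 1.
  by rewrite ltr_pM2l// (lt_trans g1)// invf_gt1.
have m0 := theta_quot1_gt0 r0 r1.
have neg x : x <= - (c * X 1) -> x < 0.
  by move=> /le_lt_trans; apply; rewrite oppr_lt0.
apply/eqP; rewrite eq_le; apply/andP; split.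
  apply: (zolotarev_le ab m0 size_zolo_num size_zolo_den zolo_sym).
  - by rewrite monic_neq0// monic_prod_XsubC.
  - exact: coprime_zolo.
  - move=> x xE; split; last exact: zolo_bound.
    by apply: zolo_den_neq0; apply: neg; case/andP: xE.
apply: (zolotarev_ge a0 ab m0 size_zolo_num size_zolo_den zolo_sym (e := zolo_alt)).
- exact: zolo_alt_incr.
- exact: zolo_alt_itv.
- move=> i ik; have ik2 : (2 * i <= 2 * k)%N by rewrite leq_mul2l.
  split.
    by apply: zolo_den_neq0; apply: neg; case/andP: (zolo_alt_itv ik2).
  rewrite /zolo_alt zolo_uniformization ?exprn_gt0// -mulnBr.
  by rewrite theta_quot_even_pow.
- exact: zolo_alt_node.
Qed.

End ZolotarevExtremal.

(** * The closed form of the Zolotarev number *)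

Unset Implicit Arguments.

Theorem theorem3p1 (R : realType) (k : nat) (a b : R) (hk : (1 <= k)%N)
    (ha : 0 < a) (hab : a < b) :
  let rho : R := expR (pi ^+ 2 / (2 * grotzsch (a / b))) in
  let P : nat -> R := fun n =>
    \prod_(1 <= tau < n.+1)
      ((1 + rho ^- (8 * tau * k)) ^+ 4 /
       (1 + rho ^+ (4 * k) * rho ^- (8 * tau * k)) ^+ 4) in
  cvgn P /\
  zolotarev k (real_segment (- b) (- a)) (real_segment a b) =
    (4 * rho ^- (2 * k) * limn P)%:E.
Proof.
have exp_num i : (8 * i.+1 = 4 * (2 * i).+2)%N by lia.
have exp_den i : (8 * i.+1 = 4 + 4 * (2 * i).+1)%N by lia.
move=> rho P.
have b0 : 0 < b by apply: lt_trans hab.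
pose l := a / b.
have l01 : 0 < l < 1 by rewrite divr_gt0//= ltr_pdivrMr// mul1r.
pose N := period_ratio l.
have N0 : 0 < N := period_ratio_gt0 l01.
have kR : 0 < k%:R :> R by rewrite ltr0n.
have kn0 : k%:R != 0 :> R by rewrite gt_eqF.
have Nn0 : N != 0 by rewrite gt_eqF.
have muE : 2 * grotzsch l = N.
  rewrite /grotzsch /N /period_ratio.
  by rewrite mulrA [2 * (pi / 2)]mulrC divfK ?pnatr_eq0// mulrA.
have rhoE : rho = expR (pi ^+ 2 / N) by rewrite /rho -/l muE.
pose r := expR (- (N / (4 * k%:R))).
have r0 : 0 < r by exact: expR_gt0.
have r1 : r < 1.
  by rewrite -expR0 ltr_expR oppr_lt0 divr_gt0// mulr_gt0.
have rk : r ^+ k = expR (- (N / 4)).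
  rewrite /r -expRM_natl; congr expR; field; by rewrite kn0.
have gE : theta_ratio (r ^+ k) 1 ^+ 2 = l by rewrite rk theta_ratio_period.
pose s := expR (- (k%:R * pi ^+ 2 / N)).
have pi0 : 0 < (pi : R) := pi_gt0 R.
have s0 : 0 < s by exact: expR_gt0.
have s1 : s < 1.
  by rewrite -expR0 ltr_expR oppr_lt0 divr_gt0// mulr_gt0// exprn_gt0.
have ZE : theta_quot r 1 ^+ 2 = theta_ratio s 1 ^+ 2.
  rewrite theta_imaginary_transformation ?r0// /s; congr (theta_ratio (expR _) 1 ^+ 2).
  rewrite /r expRK; move: (pi : R) => p; field; by rewrite kn0 Nn0.
have rhoX n : rho ^- n = expR (- (n%:R * pi ^+ 2 / N)).
  by rewrite rhoE -expRM_natl -expRN mulrA.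
have rhos n : rho ^- (n * k) = s ^+ n.
  rewrite rhoX /s -expRM_natl natrM; congr expR; move: (pi : R) => p; field; exact: Nn0.
have PE : P = (fun n => (\prod_(i < n) ((1 + (s ^+ 4) ^+ (2 * i).+2) ^+ 2 /
                          (1 + (s ^+ 4) ^+ (2 * i).+1) ^+ 2)) ^+ 2).
  apply/funext => n; rewrite /P big_add1 big_mkord -prodrXl; apply: eq_bigr => i _.
  have e1 : rho ^- (8 * i.+1 * k) = (s ^+ 4) ^+ (2 * i).+2.
    by rewrite rhos -exprM exp_num.
  have e2 : rho ^+ (4 * k) * rho ^- (8 * i.+1 * k) = (s ^+ 4) ^+ (2 * i).+1.
    rewrite rhos -[rho ^+ _]invrK rhos -exprM.
    apply: (canLR (mulKf _)); first by rewrite expf_neq0 ?gt_eqF.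
    by rewrite -exprD exp_den.
  by rewrite e2 e1 expr_div_n -!exprM.
have Plim : P n @[n --> \oo] --> (theta_ratio s 1 / (2 * s)) ^+ 2.
  rewrite PE expr2; under eq_fun do rewrite expr2.
  by apply: cvgM; exact: theta_ratio1_prod.
split; first by apply/cvg_ex; eexists; exact: Plim.
rewrite (cvg_lim _ Plim)// rhos.
pose c := Num.sqrt (a * b).
have c0 : 0 < c by rewrite sqrtr_gt0 mulr_gt0.
have q0 : 0 < r ^+ k by rewrite exprn_gt0.
have q1 : r ^+ k < 1 by rewrite exprn_ilt1 ?(ltW r0)// -lt0n.
have g0 := theta_ratio_gt0 q0 q1 ltr01.
have cg : c * theta_ratio (r ^+ k) 1 = a.
  apply/eqP; rewrite -(@eqrXn2 _ 2) ?(mulr_ge0 (ltW c0) (ltW g0)) ?(ltW ha)//.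
  rewrite exprMn gE /l sqr_sqrtr ?mulr_ge0 ?(ltW ha) ?(ltW b0)//; apply/eqP; field.
  by rewrite gt_eqF.
have cgV : c / theta_ratio (r ^+ k) 1 = b.
  apply/eqP; rewrite -(@eqrXn2 _ 2) ?(divr_ge0 (ltW c0) (ltW g0)) ?(ltW b0)//.
  rewrite expr_div_n gE /l sqr_sqrtr ?mulr_ge0 ?(ltW ha) ?(ltW b0)//; apply/eqP; field.
  by rewrite !gt_eqF.
have := zolotarev_theta hk c0 r0 r1; rewrite cg cgV => ->.
rewrite ZE; congr (_%:E); field.
by rewrite gt_eqF.
Qed.
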